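(* Let $(U_1,V_1),\dots,(U_n,V_n)$, $n\in\mathbb{N}$, be independent copies of a random vector $(U,V)$ whose distribution function is a bivariate copula $C$. Let $U_{1:n}\le\dots\le U_{n:n}$ and $V_{1:n}\le\dots\le V_{n:n}$ be the order statistics of $U_1,\dots,U_n$ and of $V_1,\dots,V_n$, respectively. Then for $1\le k,m\le n$ and for almost every $x,y\in[0,1]$ $$P(U_{m:n}\le x\mid V_{k:n}=y)= P\left(\sum_{i=1}^{k-1}1_{[0,x]}\left(U_i^{(1)}\right)+\sum_{i=1}^{n-k}1_{[0,x]}\left(U_i^{(2)}\right)\ge m\right)$$ $$\qquad+\ \frac{\partial}{\partial y}C(x,y)\; P\left(\sum_{i=1}^{k-1}1_{[0,x]}\left(U_i^{(1)}\right)+\sum_{i=1}^{n-k}1_{[0,x]}\left(U_i^{(2)}\right)= m-1\right),$$ where $U_1^{(1)},\dots,U_k^{(1)},U_1^{(2)},\dots,U_{n-k}^{(2)}$ are independent random variables (whose distributions depend on $y$) with $$P\left(U_i^{(1)}\le u\right)=P(U\le u\mid V\le y)=\frac{C(u,y)}{y}$$ and $$P\left(U_i^{(2)}\le u\right)=P(U\le u\mid V>y)=\frac{u-C(u,y)}{1-y},\qquad 0\le u\le 1.$$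
   Context: A bivariate copula $C$ is the joint distribution function of a random vector $(U,V)$ such that $U$ and $V$ are each uniformly distributed on $(0,1)$. Order statistics are taken componentwise: $U_{m:n}$ is the $m$-th smallest of $U_1,\dots,U_n$ and $V_{k:n}$ is the $k$-th smallest of $V_1,\dots,V_n$. $P(U_{m:n}\le x\mid V_{k:n}=y)$ denotes the conditional distribution function of $U_{m:n}$ given $V_{k:n}=y$. $1_A$ denotes the indicator function of the set $A$, and empty sums are $0$. It is known that for every $x\in[0,1]$ the partial derivative $\frac{\partial}{\partial y}C(x,y)$ (with respect to the second argument) exists for Lebesgue-almost all $y\in[0,1]$, and lies in $[0,1]$; ''almost every'' is with respect to Lebesgue measure. *)

(* Defs.v *)
From HB Require Import structures.
From mathcomp Require Import all_boot all_order all_algebra.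
From mathcomp Require Import all_classical all_reals all_analysis.

Set Implicit Arguments.
Unset Strict Implicit.
Unset Printing Implicit Defensive.

Import Order.TTheory GRing.Theory Num.Theory.
Import numFieldNormedType.Exports.

Local Open Scope classical_set_scope.
Local Open Scope ring_scope.

Definition joint_cdf (R : realType) (d : measure_display) (T : measurableType d)
    (P : probability T R) (U V : T -> R) (u v : R) : R :=
  fine (P [set t | U t <= u /\ V t <= v]).

Definition copula (R : realType) (C : R -> R -> R) : Prop :=
  exists (d : measure_display) (T : measurableType d) (P : probability T R)
         (U V : {RV P >-> R}),
    [/\ forall A : set R, measurable A ->
          distribution P U A = uniform_prob (@ltr01 R) A,
        forall A : set R, measurable A ->
          distribution P V A = uniform_prob (@ltr01 R) A
      & C = joint_cdf P U V].

(* P(A | B), meaningful only when P B > 0. *)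
Definition cond_prob (R : realType) (d : measure_display)
    (T : measurableType d) (P : probability T R) (A B : set T) : R :=
  fine (P (A `&` B)) / fine (P B).

Definition mutually_independent (R : realType) (d d' : measure_display)
    (T : measurableType d) (E : measurableType d') (P : probability T R)
    (I : finType) (X : I -> T -> E) : Prop :=
  forall (J : {set I}) (A : I -> set E),
    (forall i, i \in J -> measurable (A i)) ->
    fine (P (\bigcap_(i in [set` J]) X i @^-1` A i)) =
    \prod_(i in J) fine (P (X i @^-1` A i)).

Definition same_law (R : realType) (d1 d2 d' : measure_display)
    (T1 : measurableType d1) (T2 : measurableType d2) (E : measurableType d')
    (P1 : probability T1 R) (P2 : probability T2 R)
    (X1 : T1 -> E) (X2 : T2 -> E) : Prop :=
  forall A : set E, measurable A -> P1 (X1 @^-1` A) = P2 (X2 @^-1` A).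

(* The m-th smallest of the X i, with m counted from 1. *)
Definition order_stat (R : realType) (T : Type) (n : nat)
    (X : 'I_n -> T -> R) (m : nat) (t : T) : R :=
  nth 0 (sort <=%R [seq X i t | i <- enum 'I_n]) m.-1.

(* kappa is a (regular) conditional distribution of X given Y: the number
   P(X \in A | Y = y) is kappa y A. *)
Definition cond_distribution (R : realType) (d : measure_display)
    (T : measurableType d) (P : probability T R) (X Y : T -> R)
    (kappa : R.-pker R ~> R) : Prop :=
  forall A B : set R, measurable A -> measurable B ->
    P ((X @^-1` A) `&` (Y @^-1` B)) =
    (\int[pushforward P Y]_(y in B) kappa y A)%E.

Definition join_families (I J : Type) (S : Type) (X : I -> S) (Y : J -> S)
    (s : I + J) : S :=
  match s with inl i => X i | inr j => Y j end.

(* The number of the first k - 1 of the X i, and of all the Y j, that lie in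
   [0, x]. *)
Definition count_le (R : realType) (T : Type) (k l : nat)
    (X : 'I_k -> T -> R) (Y : 'I_l -> T -> R) (x : R) (t : T) : R :=
  \sum_(i < k | (i < k.-1)%N) \1_(`[0, x]%classic) (X i t) +
  \sum_(j < l) \1_(`[0, x]%classic) (Y j t).

(* Main.v *)
(** Put c = C(x,y). The indicators of U <= x and V <= y have the joint
    generating function Q = A Y + B, where A = c X + (y - c) and
    B = (x - c) X + (1 - y - x + c), so that P(U_{m:n} <= x, V_{k:n} <= y) is
    the sum of the coefficients of X^i Y^j in Q^n over i >= m and j >= k. Where
    c' = dC/dy exists, dQ/dy = (c' X + 1 - c') (Y - 1), and the sum over j
    telescopes: the y-derivative of this probability is the sum over i >= m of
    the coefficients of n binom(n-1,k-1) (c' X + 1 - c') A^(k-1) B^(n-k). For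
    m = 0 this is the density of V_{k:n}; by Lebesgue differentiation the
    derivative is, for almost every y, this density times
    P(U_{m:n} <= x | V_{k:n} = y). Dividing by y^(k-1) (1-y)^(n-k) turns
    A^(k-1) B^(n-k) into the generating function of the count N of the
    theorem. All of this holds for each x and almost every y; the exceptional
    set is Borel in (x,y), hence null for the product measure. *)

Require Import Defs.
From HB Require Import structures.
From mathcomp Require Import all_boot all_order all_algebra.
From mathcomp Require Import all_classical all_reals all_analysis.
From mathcomp Require Import measurable_realfun ring.

Set Implicit Arguments.
Unset Strict Implicit.
Unset Printing Implicit Defensive.

Import Order.TTheory GRing.Theory Num.Theory.
Import numFieldNormedType.Exports.

Local Open Scope classical_set_scope.
Local Open Scope ring_scope.

(** * Finite families of discrete states *)

Lemma measurable_preimage_bool (d : measure_display) (T : measurableType d)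
    (f : T -> bool) (b : bool) : measurable_fun [set: T] f ->
  measurable (f @^-1` [set b]).
Proof. by move=> mf; have := mf measurableT [set b] I; rewrite setTI. Qed.

Lemma measurable_set_bool (d : measure_display) (T : measurableType d)
    (f : T -> bool) : measurable_fun [set: T] f -> measurable [set t | f t].
Proof. exact: (@measurable_preimage_bool _ _ f true). Qed.

Lemma measurable_set_ler (R : realType) (d : measure_display)
    (T : measurableType d) (f g : T -> R) :
  measurable_fun [set: T] f -> measurable_fun [set: T] g ->
  measurable [set t | f t <= g t].
Proof.
by move=> mf mg; apply: measurable_set_bool; exact: measurable_fun_ler.
Qed.

Lemma set_states_bigcup (T : Type) (I S : finType) (st : I -> T -> S)
    (Q : pred {ffun I -> S}) :
  [set t | Q [ffun i => st i t]] =
  \bigcup_(s in [set s : {ffun I -> S} | Q s]) [set t | forall i, st i t = s i].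
Proof.
apply/seteqP; split => t /=.
  by move=> h; exists [ffun i => st i t] => //= i; rewrite ffunE.
move=> [s /= Qs h]; suff -> : [ffun i => st i t] = s by [].
by apply/ffunP => i; rewrite ffunE h.
Qed.

Lemma measurable_set_state (d : measure_display) (T : measurableType d)
    (I S : finType) (st : I -> T -> S) (s : {ffun I -> S}) :
  (forall i a, measurable (st i @^-1` [set a])) ->
  measurable [set t | forall i, st i t = s i].
Proof.
move=> mst; have -> : [set t | forall i, st i t = s i] =
    \bigcap_(i in [set: I]) (st i @^-1` [set s i]).
  by apply/seteqP; split => t /= h i; [move=> _; exact: h | exact: h].
apply: fin_bigcap_measurable; first exact: finite_finset.
by move=> i _; exact: mst.
Qed.

Lemma measurable_set_states (d : measure_display) (T : measurableType d)
    (I S : finType) (st : I -> T -> S) (Q : pred {ffun I -> S}) :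
  (forall i a, measurable (st i @^-1` [set a])) ->
  measurable [set t | Q [ffun i => st i t]].
Proof.
move=> mst; rewrite set_states_bigcup.
apply: fin_bigcup_measurable; first exact: finite_finset.
by move=> s _; exact: measurable_set_state.
Qed.

(** A predicate of the state vector is a finite disjoint union of elementary events, one for each
    admissible [s]. The product hypothesis is the form in which independence of the states
    enters. *)
Lemma prob_set_states (R : realType) (d : measure_display)
    (T : measurableType d) (P : probability T R) (I S : finType)
    (st : I -> T -> S) (p : I -> S -> R) (Q : pred {ffun I -> S}) :
  (forall i a, measurable (st i @^-1` [set a])) ->
  (forall s : {ffun I -> S},
    fine (P [set t | forall i, st i t = s i]) = \prod_i p i (s i)) ->
  fine (P [set t | Q [ffun i => st i t]]) = \sum_(s | Q s) \prod_i p i (s i).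
Proof.
move=> mst hp.
pose E (s : {ffun I -> S}) := [set t | forall i, st i t = s i].
have mE s : measurable (E s) by exact: measurable_set_state.
have tE : trivIset [set s | Q s] E.
  move=> s1 s2 _ _ [t [/= h1 h2]]; apply/ffunP => i.
  by rewrite -h1 h2.
have fS : finite_set [set s | Q s] by exact: finite_finset.
rewrite set_states_bigcup measure_fin_bigcup//; last by move=> s _; exact: mE.
rewrite -(@bigfs _ _ _ _ (index_enum _))//=; last first.
- by move=> s _; rewrite mem_index_enum.
- exact: index_enum_uniq.
rewrite (eq_bigr (fun s => (fine (P (E s)))%:E)); last first.
  by move=> s _; rewrite fineK// fin_num_measure.
by rewrite sumEFin /=; apply: eq_bigr => s _; exact: hp.
Qed.

(** * The generating function of a pair of counts *)

(** The binomial formula, over a general ring because [a] and [b] will be polynomials themselves,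
    namely the two coefficients of [pair_pgf]. *)
Lemma coef_affineX (S : comNzRingType) (a b : S) (N j : nat) :
  ((a *: 'X + b%:P) ^+ N)`_j = (a ^+ j * b ^+ (N - j)) *+ 'C(N, j).
Proof.
rewrite addrC exprDn coef_sum.
rewrite (eq_bigr (fun i : 'I_N.+1 =>
    (a ^+ i * b ^+ (N - i)) *+ 'C(N, i) * (j == i)%:R)); last first.
  move=> i _; rewrite coefMn -rmorphXn /= exprZn -scalerAr coefZ coefCM coefXn.
  by rewrite mulrA mulrnAl.
have [jN|Nj] := ltnP j N.+1; last first.
  rewrite bin_small// mulr0n big1// => i _.
  by rewrite gtn_eqF ?mulr0// (leq_trans _ Nj).
rewrite (bigD1 (Ordinal jN))//= eqxx mulr1 big1 ?addr0// => i /eqP ij.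
by case: eqP => [e|_]; [case: ij; exact/val_inj | rewrite mulr0].
Qed.

Lemma is_derive_sum_nat (R : realType) (m n : nat) (h : nat -> R -> R) (y : R)
    (dh : nat -> R) :
  (forall i, is_derive y 1 (h i) (dh i)) ->
  is_derive y 1 (\sum_(m <= i < n) h i) (\sum_(m <= i < n) dh i).
Proof.
move=> hd; elim/big_ind2 : _ => // [|f df g dg hf hg].
  exact: is_derive_cst.
exact: is_deriveD.
Qed.

Section bivariate.
Variable R : realType.
Implicit Types (C : R -> R) (x y c : R).

(* [pair_pgf c x y] is the generating function of the indicators of [U <= x]
   (inner variable) and [V <= y] (outer variable), where [c] stands for
   [P(U <= x, V <= y)]. *)
Definition below_pgf (c y : R) : {poly R} := c *: 'X + (y - c)%:P.
Definition above_pgf (c x y : R) : {poly R} :=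
  (x - c) *: 'X + (1 - y - (x - c))%:P.
Definition pair_pgf (c x y : R) : {poly {poly R}} :=
  below_pgf c y *: 'X + (above_pgf c x y)%:P.

(** The inner index [i] counts the points with U <= x and the outer index [j] those with V <= y. For
    the n-th power of [pair_pgf] this is the probability of at least [m] of the former and at least
    [k] of the latter. *)
Definition upper_sum (n k m : nat) (p : {poly {poly R}}) : R :=
  \sum_(m <= i < n.+1) \sum_(k <= j < n.+1) p`_j`_i.

(** Derivatives of polynomial-valued maps are taken coefficient by coefficient, so that no topology
    on polynomials is involved. *)
Definition coef_is_derive (q : R -> {poly {poly R}}) (y : R)
    (dq : {poly {poly R}}) :=
  forall i j, is_derive y 1 (fun z => (q z)`_j`_i) dq`_j`_i.

Lemma coef_is_deriveM (p q : R -> {poly {poly R}}) y dp dq :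
  coef_is_derive p y dp -> coef_is_derive q y dq ->
  coef_is_derive (fun z => p z * q z) y (dp * q y + p y * dq).
Proof.
move=> hp hq i j.
have -> : (fun z => (p z * q z)`_j`_i) =
    \sum_(a < j.+1) \sum_(b < i.+1)
       ((fun z => (p z)`_a`_b) * (fun z => (q z)`_(j - a)`_(i - b))).
  apply/funext => z; rewrite coefM coef_sum fct_sumE.
  by apply: eq_bigr => a _; rewrite coefM fct_sumE.
apply: is_derive_eq.
  apply: is_derive_sum => a; apply: is_derive_sum => b.
  exact: is_deriveM.
rewrite coefD !coefM coefD !coef_sum -big_split; apply: eq_bigr => a _ /=.
rewrite !coefM -big_split; apply: eq_bigr => b _ /=.
by rewrite addrC; congr (_ + _); exact: mulrC.
Qed.

Lemma coef_is_deriveX (q : R -> {poly {poly R}}) y dq n :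
  coef_is_derive q y dq ->
  coef_is_derive (fun z => q z ^+ n.+1) y (n.+1%:R *: (q y ^+ n * dq)).
Proof.
move=> hq; elim: n => [|n IHn].
  by rewrite scale1r expr0 mul1r.
have -> : (fun z => q z ^+ n.+2) = (fun z => q z * q z ^+ n.+1).
  by apply/funext => z; rewrite exprS.
have -> : n.+2%:R *: (q y ^+ n.+1 * dq) =
    dq * q y ^+ n.+1 + q y * (n.+1%:R *: (q y ^+ n * dq)).
  rewrite -scalerAr mulrA -exprS [dq * _]mulrC.
  by rewrite -[X in X + _]scale1r -scalerDl addrC -natr1.
exact: coef_is_deriveM.
Qed.

(** Expanded, Q = 1 + x (X - 1) + y (Y - 1) + C(y) (X - 1) (Y - 1), which is affine in y and C(y);
    the derivative is therefore (1 + c (X - 1)) (Y - 1). *)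
Lemma coef_pair_pgf_is_derive C x y c : is_derive y 1 C c ->
  coef_is_derive (fun z => pair_pgf (C z) x z) y
    ((c *: 'X + (1 - c)%:P) *: ('X - 1)).
Proof.
move=> hC i j.
have hid : is_derive y 1 (fun z : R => z) 1 by exact: is_derive_id.
have affine_derive (a b w : R) :
    is_derive y 1 (fun z => C z * a + z * b + w) (c * a + b).
  have -> : (fun z => C z * a + z * b + w) = a *: C + b *: id + cst w.
    by apply/funext => z; rewrite [C z * a]mulrC [z * b]mulrC.
  apply: (is_derive_eq (is_deriveD (is_deriveD (is_deriveZ a hC)
    (is_deriveZ b hid)) (is_derive_cst w y 1))).
  by rewrite /GRing.scale /= mulr1 addr0 [a * _]mulrC.
(* [e] and [o] are the coefficient sequences of the variable and of 1. Written with them, the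
   expansion of Q becomes a ring identity valid for all indices at once. *)
pose e l : R := (l == 1)%N%:R.
pose o l : R := (l == 0)%N%:R.
have aff2 (p q : {poly R}) l : (p *: 'X + q%:P)`_l =
    p * (e l)%:P + q * (o l)%:P.
  rewrite coefD coefZ coefX coefC /e /o !polyC_natr.
  by case: (l == 0)%N; rewrite ?mulr1 ?mulr0.
have aff1 (p q : R) l : (p *: 'X + q%:P)`_l = p * e l + q * o l.
  rewrite coefD coefZ coefX coefC /e /o.
  by case: (l == 0)%N; rewrite ?mulr1 ?mulr0.
have := affine_derive ((e i - o i) * (e j - o j)) (o i * (e j - o j))
  ((x * e i + (1 - x) * o i) * o j).
congr is_derive.
  apply/funext => z; rewrite /pair_pgf aff2 coefD !coefMC !aff1.
  by move: (e i) (e j) (o i) (o j) => *; ring.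
have -> : ((c *: 'X + (1 - c)%:P) *: ('X - 1))`_j =
  (c *: 'X + (1 - c)%:P) * (e j - o j)%:P.
  rewrite coefZ coefB coefX coef1; congr (_ * _).
  by rewrite /e /o polyCB !polyC_natr.
rewrite coefMC aff1.
by move: (e i) (e j) (o i) (o j) => *; ring.
Qed.

Lemma upper_sum_is_derive C x y c n k m : is_derive y 1 C c ->
  (1 <= k <= n)%N ->
  is_derive y 1 (fun z => upper_sum n k m (pair_pgf (C z) x z ^+ n))
    ((n * 'C(n.-1, k.-1))%:R * \sum_(m <= i < n.+1)
      ((c *: 'X + (1 - c)%:P) *
       (below_pgf (C y) y ^+ k.-1 * above_pgf (C y) x y ^+ (n - k)))`_i).
Proof.
case: n k => [|n] [|k]// hC /andP[_ /= kn].
have hQ := coef_is_deriveX n (coef_pair_pgf_is_derive x hC).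
set Q := pair_pgf (C y) x y in hQ *.
set g := c *: 'X + _ in hQ *; set W := _ ^+ k * _.
(* Multiplying by Y - 1 turns coefficients into differences. The upper boundary term is zero because
   [Q ^+ n] has degree at most n in Y, and the lower one is given by the binomial formula. *)
have telescope : \sum_(k.+1 <= j < n.+2) (Q ^+ n * ('X - 1))`_j = W *+ 'C(n, k).
  rewrite big_add1 /= (eq_bigr (fun j => - ((Q ^+ n)`_j.+1 - (Q ^+ n)`_j))).
    rewrite sumrN (telescope_sumr _ (ltnW kn)) opprB !coef_affineX.
    by rewrite (bin_small (ltnSn n)) mulr0n subr0.
  by move=> j _; rewrite mulrBr mulr1 coefB coefMX opprB.
have -> : (n.+1 * 'C(n, k))%:R * (\sum_(m <= i < n.+2) (g * W)`_i) =
    \sum_(m <= i < n.+2) \sum_(k.+1 <= j < n.+2)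
      (n.+1%:R *: (Q ^+ n * (g *: ('X - 1))))`_j`_i.
  rewrite mulr_sumr; apply: eq_bigr => i _.
  rewrite -coef_sum.
  rewrite (eq_bigr (fun j => (n.+1%:R * g) * (Q ^+ n * ('X - 1))`_j));
    last by move=> j _; rewrite coefZ -scalerAr coefZ mulrA.
  rewrite mulr_natl -mulr_sumr telescope mulrnAr -mulrA mulr_natl -mulrnA.
  by rewrite coefMn.
rewrite /upper_sum.
have -> : (fun z => \sum_(m <= i < n.+2) \sum_(k.+1 <= j < n.+2)
    (pair_pgf (C z) x z ^+ n.+1)`_j`_i) =
  \sum_(m <= i < n.+2) \sum_(k.+1 <= j < n.+2)
    (fun z => (pair_pgf (C z) x z ^+ n.+1)`_j`_i).
  apply/funext => z; rewrite !fct_sumE.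
  by apply: eq_bigr => i _; rewrite fct_sumE.
apply: is_derive_sum_nat => i; apply: is_derive_sum_nat => j; exact: hQ.
Qed.

End bivariate.

(** Expanding the product chooses a value of [s i] in each factor. The mask [w] leaves some indices
    uncounted: their factors are constants. *)
Lemma sum_prod_count (R : comNzRingType) (I : finType) (w : I -> bool)
    (p : I -> bool -> R) (j : nat) :
  \sum_(s : {ffun I -> bool} | \sum_i (w i && s i : nat) == j)
     \prod_i p i (s i) =
  (\prod_i ((p i true) *: 'X^(w i) + (p i false)%:P))`_j.
Proof.
rewrite (eq_bigr (fun i => \sum_(b : bool) (p i b) *: 'X^(w i && b)));
  last by move=> i _; rewrite big_bool /= andbT andbF expr0 alg_polyC.
rewrite bigA_distr_bigA /= coef_sum big_mkcond /=; apply: eq_bigr => s _.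
rewrite scaler_prod -expr_sum coefZ coefXn eq_sym.
by case: eqP; rewrite ?mulr1 ?mulr0.
Qed.

(** Each factor of Q^n is a sum over four states. After expansion, a state vector contributes to the
    single coefficient indexed by its two counts, and these never exceed n, where the ranges of
    [upper_sum] stop. *)
Lemma sum_prod_pair_count (R : realType) (n k m : nat) (c x y : R)
    (p : bool * bool -> R) :
  p (true, true) = c -> p (true, false) = x - c ->
  p (false, true) = y - c -> p (false, false) = 1 - y - (x - c) ->
  \sum_(s : {ffun 'I_n -> bool * bool} |
      (m <= \sum_i ((s i).1 : nat))%N && (k <= \sum_i ((s i).2 : nat))%N)
     \prod_i p (s i) = upper_sum n k m (pair_pgf c x y ^+ n).
Proof.
move=> p11 p10 p01 p00.
have -> : pair_pgf c x y ^+ n = \prod_(i < n)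
    \sum_(b : bool * bool) ((p b) *: 'X^(b.1)) *: 'X^(b.2).
  rewrite prodr_const card_ord; congr (_ ^+ _).
  rewrite (eq_bigr (fun b => ((p (b.1, b.2)) *: 'X^(b.1)) *: 'X^(b.2)));
    last by case.
  rewrite -(pair_bigA _ (fun a b => ((p (a, b)) *: 'X^a) *: 'X^b)) /=.
  rewrite !big_bool /= p11 p10 p01 p00 /pair_pgf /below_pgf /above_pgf.
  rewrite !expr0 !expr1 !alg_polyC scalerDl polyCD addrACA.
  by rewrite [in LHS]polyCD.
rewrite bigA_distr_bigA /= /upper_sum.
have coefs (s : {ffun 'I_n -> bool * bool}) i j :
    (\prod_l (((p (s l)) *: 'X^((s l).1)) *: 'X^((s l).2)))`_j`_i =
    \prod_l p (s l) * (i == \sum_l (s l).1)%N%:R * (j == \sum_l (s l).2)%N%:R.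
  rewrite scaler_prod -expr_sum coefZ coefXn scaler_prod -expr_sum.
  by case: (j == _)%N; rewrite ?mulr0 ?mulr1 ?coef0// coefZ coefXn.
have count_le_n (f : 'I_n -> bool) : (\sum_l f l < n.+1)%N.
  rewrite ltnS -[leqRHS]card_ord -sum1_card leq_sum// => l _.
  by case: (f l).
have pick_nat l (a : nat) : (a < n.+1)%N ->
    \sum_(l <= i < n.+1) (i == a)%N%:R = (l <= a)%N%:R :> R.
  move=> an; rewrite (eq_bigr (fun i => if i == a then 1 else 0)).
    by rewrite -big_mkcond big_nat1_eq an andbT; case: (l <= a)%N.
  by move=> i _; case: (i == a).
rewrite (eq_bigr (fun i => \sum_(s : {ffun 'I_n -> bool * bool})
    \sum_(k <= j < n.+1) \prod_l p (s l) * (i == \sum_l (s l).1)%N%:R *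
      (j == \sum_l (s l).2)%N%:R)); last first.
  move=> i _; rewrite exchange_big /=; apply: eq_bigr => j _.
  by rewrite !coef_sum; apply: eq_bigr => s _; rewrite coefs.
rewrite exchange_big big_mkcond /=; apply: eq_bigr => s _.
under [RHS]eq_bigr => i _ do rewrite -mulr_sumr pick_nat//.
rewrite -mulr_suml -mulr_sumr pick_nat//.
by case: (m <= _)%N; case: (k <= _)%N; rewrite /= ?mulr1 ?mulr0.
Qed.

(** * Tail sums of coefficients of products with affine factors *)

Section affine_products.
Variable R : realType.
Implicit Types a b c : R.

Lemma size_affineX a b : (size (a *: 'X + b%:P)%R <= 2)%N.
Proof.
rewrite (leq_trans (size_polyD _ _))// geq_max (leq_trans (size_scale_leq _ _)).
  by rewrite (leq_trans (size_polyC_leq1 _)).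
by rewrite size_polyX.
Qed.

Lemma size_affineX_exp a b l : (size ((a *: 'X + b%:P) ^+ l)%R <= l.+1)%N.
Proof.
rewrite (leq_trans (size_poly_exp_leq _ _))// ltnS.
by rewrite -[leqRHS]mul1n leq_mul2r -subn1 leq_subLR size_affineX orbT.
Qed.

Lemma size_affineX_expM a b a' b' l l' :
  (size ((a *: 'X + b%:P) ^+ l * (a' *: 'X + b'%:P) ^+ l')%R <= (l + l').+1)%N.
Proof.
rewrite (leq_trans (size_polyMleq _ _))// -subn1 leq_subLR add1n -addSn -addnS.
exact: leq_add (size_affineX_exp a b l) (size_affineX_exp a' b' l').
Qed.

(** Since c X + 1 - c = 1 + c (X - 1), the second summand telescopes. For the generating function
    [p] of a count N, this is P(N + B >= m) = P(N >= m) + c P(N = m - 1) with m = l + 1 and B an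
    independent Bernoulli(c) variable. *)
Lemma sum_coef_affineXM c (p : {poly R}) (l n : nat) : (size p <= n)%N ->
  (l < n)%N ->
  \sum_(l.+1 <= i < n.+1) ((c *: 'X + (1 - c)%:P) * p)`_i =
  \sum_(l.+1 <= i < n) p`_i + c * p`_l.
Proof.
move=> pn ln.
have e i : ((c *: 'X + (1 - c)%:P) * p)`_i.+1 = p`_i.+1 - c * (p`_i.+1 - p`_i).
  by rewrite mulrDl -scalerAl coefD coefZ coefXM coefCM /=; ring.
rewrite big_add1 /= (eq_bigr _ (fun i _ => e i)) sumrB -mulr_sumr.
rewrite telescope_sumr ?(ltnW ln)// (nth_default _ pn) sub0r mulrN opprK.
congr (_ + _); transitivity (\sum_(l.+1 <= i < n.+1) p`_i).
  by rewrite big_add1.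
by rewrite big_nat_recr //= (nth_default _ pn) addr0.
Qed.

(** The sum of all coefficients is the value at 1, where the affine factor equals 1. *)
Lemma sum_coef_affineXM0 c (p : {poly R}) (n : nat) : (size p <= n)%N ->
  \sum_(0 <= i < n.+1) ((c *: 'X + (1 - c)%:P) * p)`_i = p.[1].
Proof.
move=> pn.
have sp : (size ((c *: 'X + (1 - c)%:P) * p)%R <= n.+1)%N.
  rewrite (leq_trans (size_polyMleq _ _))//.
  rewrite -subn1 leq_subLR.
  exact: leq_add (size_affineX c (1 - c)) pn.
rewrite big_mkord.
transitivity ((c *: 'X + (1 - c)%:P) * p).[1].
  rewrite (horner_coef_wide _ sp); apply: eq_bigr => i _.
  by rewrite expr1n mulr1.
by rewrite !hornerE /= addrAC subrr add0r mul1r.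
Qed.

End affine_products.

(** * Order statistics and margins *)

(** In the sorted list, a k-th entry at most [y] has k - 1 entries below it that are at most [y]
    too, while a k-th entry above [y] leaves at most k - 1 candidates, those before it. *)
Lemma order_stat_le (R : realType) (T : Type) (n : nat) (X : 'I_n -> T -> R)
    (k : nat) (t : T) (y : R) : (1 <= k <= n)%N ->
  (order_stat X k t <= y) = (k <= \sum_i ((X i t <= y)%R : nat))%N.
Proof.
case: k => [//|k] /andP[_ kn]; rewrite /order_stat /=.
set s := [seq X i t | i <- enum 'I_n].
have ss : size (sort <=%R s) = n by rewrite size_sort size_map size_enum_ord.
have -> : (\sum_i ((X i t <= y)%R : nat))%N = count (<= y) (sort <=%R s).
  rewrite count_sort count_map -sum1_count big_enum_cond /= [RHS]big_mkcond /=.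
  by apply: eq_bigr => i _; case: (_ <= _).
have sorted_s := sort_le_sorted s.
apply/idP/idP => [sk|].
  rewrite -(cat_take_drop k.+1 (sort <=%R s)) count_cat.
  rewrite (leq_trans _ (leq_addr _ _))//.
  have -> : count (<= y) (take k.+1 (sort <=%R s)) = k.+1.
    transitivity (size (take k.+1 (sort <=%R s)));
      last by rewrite size_takel ?ss.
    apply/eqP; rewrite -all_count; apply/(all_nthP 0) => i.
    rewrite size_takel ?ss// => ik; rewrite nth_take//= (le_trans _ sk)//.
    by apply: le_sorted_leq_nth => //; rewrite inE ss// (leq_trans ik).
  by [].
apply: contraTT; rewrite -ltNge -ltnNge => sk.
rewrite -(cat_take_drop k (sort <=%R s)) count_cat.
have -> : count (<= y) (drop k (sort <=%R s)) = 0%N.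
  apply/eqP; rewrite -leqn0 leqNgt -has_count; apply/(has_nthP 0) => -[i].
  rewrite size_drop ss => ik; rewrite nth_drop /= leNgt (lt_le_trans sk)//.
  apply: le_sorted_leq_nth => //; rewrite ?inE ?ss ?leq_addr//.
  by rewrite -ltn_subRL.
by rewrite addn0 ltnS (leq_trans (count_size _ _))// size_takel// ss ltnW.
Qed.

Lemma measurable_order_stat (R : realType) (d : measure_display)
    (T : measurableType d) (n : nat) (X : 'I_n -> T -> R) (k : nat) :
  (1 <= k <= n)%N -> (forall i, measurable_fun [set: T] (X i)) ->
  measurable_fun [set: T] (order_stat X k).
Proof.
move=> kn mX; apply: (measurability (@RGenOInfty.G R)).
  exact: RGenOInfty.measurableE.
move=> _ [_ [y ->] <-]; rewrite setTI.
have -> : order_stat X k @^-1` `]y, +oo[ =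
    ~` [set t | (k <= \sum_i ((X i t <= y)%R : nat))%N].
  apply/seteqP; split => t /=; rewrite in_itv /= andbT ltNge order_stat_le//.
    by move=> h; apply/negP.
  by move=> h; apply/negP.
apply: measurableC.
have -> : [set t | (k <= \sum_i ((X i t <= y)%R : nat))%N] =
    [set t | (fun s : {ffun 'I_n -> bool} => (k <= \sum_i s i)%N)
               [ffun i => (X i t <= y)%R]].
  apply/seteqP; split => t /= h; apply: leq_trans h _; apply/eq_leq.
    by apply: eq_bigr => i _; rewrite ffunE.
  by apply: eq_bigr => i _; rewrite ffunE.
apply: (@measurable_set_states _ _ _ _ (fun i t => (X i t <= y)%R)
  (fun s => (k <= \sum_i s i)%N)) => i b.
by apply: measurable_preimage_bool; exact: measurable_fun_ler.
Qed.

Section real_law.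
Variables (R : realType) (d : measure_display) (T : measurableType d).
Variables (P : {finite_measure set T -> \bar R}) (Y : T -> R).

(* The pushforward on [measurableTypeR R], the type on which the library puts
   Lebesgue measure; its display differs from that of [R] itself. *)
Definition real_law of measurable_fun [set: T] Y :
    set (measurableTypeR R) -> \bar R :=
  fun A => P (Y @^-1` A).

Hypothesis mY : measurable_fun [set: T] Y.

Let mYR : measurable_fun [set: T] (Y : T -> measurableTypeR R).
Proof. by []. Qed.

Let pushed :=
  measure_function_pushforward__canonical__measure_function_Measure P mYR.

Let law0 : real_law mY set0 = 0%E.
Proof. by rewrite /real_law preimage_set0 measure0. Qed.

Let law_ge0 A : (0 <= real_law mY A)%E.
Proof. exact: measure_ge0. Qed.

Let law_sigma_additive : semi_sigma_additive (real_law mY).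
Proof. exact: (@measure_semi_sigma_additive _ _ _ pushed). Qed.

HB.instance Definition _ := isMeasure.Build _ _ _ (real_law mY)
  law0 law_ge0 law_sigma_additive.

Let law_finite : fin_num_fun (real_law mY).
Proof.
move=> A mA; apply: fin_num_measure.
by rewrite -[X in measurable X]setTI; exact: mYR.
Qed.

HB.instance Definition _ := @Measure_isFinite.Build _ _ _
  (real_law mY) law_finite.

End real_law.

Section real_law_probability.
Variables (R : realType) (d : measure_display) (T : measurableType d).
Variables (P : probability T R) (Y : T -> R).
Hypothesis mY : measurable_fun [set: T] Y.

Let lawT : real_law P mY [set: R] = 1%E.
Proof.
by rewrite /real_law preimage_setT; exact: (@probability_setT _ _ _ P).
Qed.

HB.instance Definition _ := @Measure_isProbability.Build _ _ R
  (real_law P mY) lawT.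

End real_law_probability.

(** Continuity from below, as the events V <= n exhaust the space. It recovers a margin from the
    joint distribution function alone. *)
Lemma joint_cdf_cvg (R : realType) (d : measure_display) (T : measurableType d)
    (P : probability T R) (U V : {RV P >-> R}) (u : R) :
  joint_cdf P U V u n%:R @[n --> \oo] --> fine (P [set t | U t <= u]).
Proof.
have mle (X : {RV P >-> R}) x : measurable [set t | X t <= x].
  by apply: measurable_set_ler => //; exact: measurable_funPT.
have cup : \bigcup_n [set t | U t <= u /\ V t <= n%:R] = [set t | U t <= u].
  apply/seteqP; split => t /=; first by move=> [n _ []].
  move=> Uu; have [n Vn] : exists n, V t < n%:R.
    by exists (Num.truncn (V t)).+1; exact: truncnS_gt.
  by exists n => //=; split => //; exact: ltW.
apply: fine_cvg; rewrite fineK ?fin_num_measure// -cup.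
apply: nondecreasing_cvg_mu.
- by move=> n; apply: measurableI; exact: mle.
- by rewrite cup.
- move=> a b ab; apply/subsetPset => t /= [Uu Va]; split => //.
  by rewrite (le_trans Va)// ler_nat.
Qed.

(** The open upper rays are stable under intersection and generate the Borel sets; their
    probabilities are one minus values of the distribution function. *)
Lemma probability_eq_of_cdf (R : realType)
    (mu nu : probability (measurableTypeR R) R) :
  (forall x : R, mu `]-oo, x]%classic = nu `]-oo, x]%classic) ->
  forall A, measurable A -> mu A = nu A.
Proof.
move=> munu A mA.
apply: (@measure_unique _ R (measurableTypeR R) (@RGenOInfty.G R)
  (fun n => `]- n%:R, +oo[%classic)) => //.
- exact: RGenOInfty.measurableE.
- move=> _ _ [a ->] [b ->]; exists (Num.max a b).
  by apply/seteqP; split => z /=; rewrite !in_itv /= !andbT gt_max => /andP.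
- by move=> i; exists (- i%:R).
- apply/seteqP; split => // z _; exists (Num.truncn (- z)).+1 => //=.
  by rewrite in_itv /= andbT ltrNl; exact: truncnS_gt.
- move=> _ [a ->]; have compl (la : probability (measurableTypeR R) R) :
      la `]a, +oo[%classic = (1 - la `]-oo, a]%classic)%E.
    by rewrite -setCitvl; exact: probability_setC.
  by rewrite [LHS]compl [RHS]compl munu.
- move=> n; apply: (@le_lt_trans _ _ 1%E); last exact: ltry.
  exact: probability_le1.
Qed.

Lemma uniform_prob_itv (R : realType) (x : R) : 0 <= x <= 1 ->
  uniform_prob (@ltr01 R) `]-oo, x]%classic = x%:E.
Proof.
move=> /andP[x0 x1]; rewrite /uniform_prob integral_uniform_pdf.
have -> : `]-oo, x] `&` `[0, 1] = `[0%R, x]%classic.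
  apply/seteqP; split => z /=; rewrite !in_itv /=.
    by move=> [zx /andP[-> _]].
  by move=> /andP[z0 zx]; rewrite zx z0 (le_trans zx).
rewrite (eq_integral (fun=> 1%E)); last first.
  move=> z; rewrite inE /= in_itv /= => /andP[z0 zx].
  by rewrite /uniform_pdf z0 (le_trans zx)// subr0 invr1.
rewrite integral_cst//= mul1e lebesgue_measure_itv /= lte_fin.
by case: ltgtP x0 => // [_ _|<- _]; rewrite -?EFinD ?subr0.
Qed.

Section copula_margins.
Variables (R : realType) (C : R -> R -> R) (d : measure_display).
Variables (T : measurableType d) (P : probability T R) (U V : {RV P >-> R}).
Hypotheses (hC : copula C) (hUV : joint_cdf P U V = C).

Lemma joint_cdfC (d' : measure_display) (T' : measurableType d')
    (P' : probability T' R) (X Y : T' -> R) u v :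
  joint_cdf P' X Y u v = joint_cdf P' Y X v u.
Proof.
by rewrite /joint_cdf; congr (fine (P' _)); apply/seteqP; split => t [].
Qed.

(** The hypothesis [copula C] gives uniform margins to some vector with distribution function C, not
    necessarily to the given (U, V). Both margins are the limit of the same sequence C(u, n). *)
Lemma copula_margin1 u :
  fine (P [set t | U t <= u]) =
  fine (uniform_prob (@ltr01 R) `]-oo, u]%classic).
Proof.
have [d' [T' [P' [U' [V' [hU' _ hC']]]]]] := hC.
have hU := @joint_cdf_cvg _ _ _ P U V u; rewrite hUV hC' in hU.
rewrite (cvg_unique (@Rhausdorff R) hU (@joint_cdf_cvg _ _ _ P' U' V' u)).
rewrite -hU'//; congr (fine (P' _)).
Qed.

Lemma copula_margin2 v :
  fine (P [set t | V t <= v]) =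
  fine (uniform_prob (@ltr01 R) `]-oo, v]%classic).
Proof.
have [d' [T' [P' [U' [V' [_ hV' hC']]]]]] := hC.
have hV := @joint_cdf_cvg _ _ _ P V U v.
have e : (fun n => joint_cdf P V U v n%:R) =
    (fun n => joint_cdf P' V' U' v n%:R).
  by apply/funext => n; rewrite joint_cdfC hUV hC' joint_cdfC.
rewrite e in hV.
rewrite (cvg_unique (@Rhausdorff R) hV (@joint_cdf_cvg _ _ _ P' V' U' v)).
rewrite -hV'//; congr (fine (P' _)).
Qed.

Lemma copula_law2 (A : set R) : measurable A ->
  P (V @^-1` A) = uniform_prob (@ltr01 R) A.
Proof.
move=> mA.
apply: (@probability_eq_of_cdf R (real_law P (@measurable_funPT _ _ _ _ V))
  (uniform_prob (@ltr01 R))) => //.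
move=> v; rewrite -[LHS]fineK ?fin_num_measure// -[RHS]fineK ?fin_num_measure//.
rewrite -copula_margin2; congr (_%:E); congr (fine (P _)).
Qed.

End copula_margins.

(** * Joint distribution function of two order statistics *)

Section order_stats_law.
Variables (R : realType) (C : R -> R -> R) (d0 : measure_display).
Variables (T0 : measurableType d0) (P0 : probability T0 R).
Variables (U V : {RV P0 >-> R}).
Hypotheses (hC : copula C) (hUV : joint_cdf P0 U V = C).
Variables (n : nat) (d : measure_display) (T : measurableType d).
Variables (P : probability T R) (Us Vs : 'I_n -> {RV P >-> R}).
Hypothesis hcopy : forall i : 'I_n,
  same_law P P0 (fun t => (Us i t, Vs i t)) (fun t => (U t, V t)).
Hypothesis hindep :
  mutually_independent P (fun (i : 'I_n) t => (Us i t, Vs i t)).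

Let quadrant (x y : R) (a : bool * bool) : set (R * R) :=
  [set uv | (uv.1 <= x, uv.2 <= y) = a].

Let measurable_quadrant x y a : measurable (quadrant x y a).
Proof.
have half z b : measurable [set u : R | (u <= z) = b].
  by apply: measurable_preimage_bool; apply: measurable_fun_ler => //;
    exact: measurable_id.
have -> : quadrant x y a =
    [set u : R | (u <= x) = a.1] `*` [set v : R | (v <= y) = a.2].
  case: a => a1 a2; rewrite /quadrant.
  by apply/seteqP; split => -[u v] /=; [move=> [<- <-] | move=> [-> ->]].
by apply: measurableX; exact: half.
Qed.

(** The pairs of indicators are independent, and the uniform margins fix the probabilities of the
    four quadrants. By [order_stat_le] the event says U_{m:n} <= x and V_{k:n} <= y when 1 <= k, m
    <= n; the case m = 0 gives the law of V_{k:n} alone. *)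
Lemma order_stats_cdf (k m : nat) (x y : R) : 0 <= x <= 1 -> 0 <= y <= 1 ->
  fine (P [set t | (m <= \sum_i ((Us i t <= x)%R : nat))%N &&
                   (k <= \sum_i ((Vs i t <= y)%R : nat))%N]) =
  upper_sum n k m (pair_pgf (C x y) x y ^+ n).
Proof.
move=> x01 y01.
pose p a := fine (P0 ((fun t => (U t, V t)) @^-1` quadrant x y a)).
have pE a S : (forall t, quadrant x y a (U t, V t) <-> S t) ->
    p a = fine (P0 S).
  by move=> h; congr (fine (P0 _)); apply/seteqP; split => t /h.
have mle (X : {RV P0 >-> R}) z : measurable [set t | X t <= z].
  by apply: measurable_set_ler => //; exact: measurable_funPT.
have split_prob (A B : set T0) : measurable A -> measurable B ->
    fine (P0 A) = fine (P0 (A `\` B)) + fine (P0 (A `&` B)).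
  move=> mA mB; rewrite -fineD ?fin_num_measure//; last 2 first.
  - exact: measurableD.
  - exact: measurableI.
  by rewrite (measureDI P0 mA mB).
have px : fine (P0 [set t | U t <= x]) = x.
  by rewrite (copula_margin1 hC hUV) uniform_prob_itv.
have py : fine (P0 [set t | V t <= y]) = y.
  by rewrite (copula_margin2 hC hUV) uniform_prob_itv.
have p11 : p (true, true) = C x y.
  rewrite (pE _ [set t | U t <= x /\ V t <= y]) -?hUV// => t.
  by rewrite /quadrant /=; split => -[-> ->].
have p10 : p (true, false) = x - C x y.
  rewrite (pE _ ([set t | U t <= x] `\` [set t | V t <= y])).
    by rewrite -{2}px (split_prob _ _ (mle U x) (mle V y)) -hUV addrK.
  move=> t; rewrite /quadrant /=; split => [[-> ->]//|[-> /negP/negbTE ->//]].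
have p01 : p (false, true) = y - C x y.
  rewrite (pE _ ([set t | V t <= y] `\` [set t | U t <= x])).
    by rewrite -{2}py (split_prob _ _ (mle V y) (mle U x)) setIC -hUV addrK.
  move=> t; rewrite /quadrant /=; split => [[-> ->]//|[-> /negP/negbTE ->//]].
have p00 : p (false, false) = 1 - y - (x - C x y).
  rewrite (pE _ ((~` [set t | V t <= y]) `\` [set t | U t <= x])).
    have := split_prob _ _ (measurableC (mle V y)) (mle U x).
    rewrite setIC -setDE probability_setC// fineB ?fin_num_measure//.
    rewrite py -p10 (pE _ ([set t | U t <= x] `\` [set t | V t <= y])).
      by move=> ->; rewrite addrK.
    move=> t; rewrite /quadrant /=.
    by split => [[-> ->]//|[-> /negP/negbTE ->//]].
  move=> t; rewrite /quadrant /=; split => [[-> ->]//|].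
  by move=> [/negP/negbTE -> /negP/negbTE ->].
rewrite -(@sum_prod_pair_count R n k m (C x y) x y p)//.
pose st i t := ((Us i t <= x)%R, (Vs i t <= y)%R).
pose Q (s : {ffun 'I_n -> bool * bool}) :=
  (m <= \sum_i ((s i).1 : nat))%N && (k <= \sum_i ((s i).2 : nat))%N.
have mst i a : measurable (st i @^-1` [set a]).
  have mUV : measurable_fun [set: T] (fun t => (Us i t, Vs i t)).
    by apply: measurable_fun_pair.
  by have := mUV measurableT _ (measurable_quadrant x y a); rewrite setTI.
rewrite -(@prob_set_states R d T P 'I_n _ st (fun=> p) Q mst); last first.
  move=> s; rewrite /p.
  transitivity (fine (P (\bigcap_(i in [set` [set: 'I_n]%SET])
     (fun t => (Us i t, Vs i t)) @^-1` quadrant x y (s i)))).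
    congr (fine (P _)); apply/seteqP; split => t /= h i.
      by move=> _; exact: h.
    by apply: h; rewrite /= inE.
  rewrite hindep//; apply: eq_big => i; first by rewrite inE.
  by move=> _; rewrite (hcopy i (measurable_quadrant x y (s i))).
congr (fine (P _)); congr (mkset _); apply/funext => t; rewrite /Q /=.
by congr (is_true (_ && _)); congr (_ <= _)%N;
  apply: eq_bigr => i _; rewrite ffunE.
Qed.

End order_stats_law.

(** * Densities and almost everywhere derivatives *)

Section density.
Variable R : realType.
Local Notation leb := (@lebesgue_measure R).

Lemma ae_is_derive_integral (g : R -> R) :
  leb.-integrable [set: R] (EFin \o g) ->
  {ae leb, forall y : R, is_derive (y : R) (1 : R)
    (fun z : R => fine (\int[leb]_(t in `]-oo, z]) (g t)%:E)%E) (g y)}.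
Proof.
move=> ig.
have := @FTC1Ny R g.
move=> /(_ _ (open_integrable_locally openT ig)) h.
apply: filterS (h _); first exact: (ae_filter_ringOfSetsType leb).
  by move=> y [dg <-]; rewrite derive1E; exact: DeriveDef.
by move=> y; apply: integrableS ig.
Qed.

(** The last clause covers nonnegative integrands and not only indicators, because the conditional
    probabilities [kappa y A] will be integrated against the law of V_{k:n}. *)
Definition has_density (nu : {finite_measure set (measurableTypeR R) -> \bar R})
    (r : R -> R) : Prop :=
  [/\ forall y, 0 <= r y,
      leb.-integrable [set: R] (EFin \o r) &
      forall (f : R -> \bar R) (A : set (measurableTypeR R)),
        (forall y, (0 <= f y)%E) -> measurable A ->
        measurable_fun [set: measurableTypeR R] f ->
        (\int[nu]_(y in A) f y = \int[leb]_(y in A) (f y * (r y)%:E))%E].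

(** Radon-Nikodym; the derivative is finite everywhere, so passing to real values loses nothing. *)
Lemma density_exists (nu : {finite_measure set (measurableTypeR R) -> \bar R}) :
  (forall A : set (measurableTypeR R),
     measurable A -> leb A = 0%E -> nu A = 0%E) ->
  exists r, has_density nu r.
Proof.
move=> ac.
have dom : nu `<< leb by apply/null_content_dominatesP => A mA; exact: ac.
pose r := Radon_Nikodym_SigmaFinite.f nu leb.
have rfin y : r y = (fine (r y))%:E.
  by rewrite fineK//; exact: Radon_Nikodym_SigmaFinite.f_fin_num.
exists (fine \o r); split.
- by move=> y; apply: fine_ge0; exact: Radon_Nikodym_SigmaFinite.f_ge0.
- have -> : EFin \o (fine \o r) = r by apply/funext => y; rewrite /= -rfin.
  exact: Radon_Nikodym_SigmaFinite.f_integrable.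
- move=> f A f0 mA mf.
  rewrite -(Radon_Nikodym_SigmaFinite.change_of_variables dom)//.
    by apply: eq_integral => y _; rewrite /= -rfin.
  exact: measurable_funTS.
Qed.

Lemma density_ray (nu : {finite_measure set (measurableTypeR R) -> \bar R})
    (r : R -> R) (z : R) :
  has_density nu r ->
  fine (nu `]-oo, z]%classic) =
  fine (\int[leb]_(t in `]-oo, z]) (r t)%:E)%E.
Proof.
move=> [_ _ nuE]; congr fine; have := nuE (cst 1%E) `]-oo, z]%classic.
rewrite integral_cst// mul1e => h; apply: etrans (h _ _ _) _ => //.
by apply: eq_integral => t _; rewrite mul1e.
Qed.

End density.

Section conditional_density.
Variables (R : realType) (C : R -> R -> R) (d0 : measure_display).
Variables (T0 : measurableType d0) (P0 : probability T0 R).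
Variables (U V : {RV P0 >-> R}).
Hypotheses (hC : copula C) (hUV : joint_cdf P0 U V = C).
Local Notation leb := (@lebesgue_measure R).

Lemma copula_null2 (A : set (measurableTypeR R)) : measurable A ->
  leb A = 0%E -> P0 (V @^-1` A) = 0%E.
Proof.
move=> mA A0; rewrite (copula_law2 hC hUV)//.
by have /null_content_dominatesP := dominates_uniform_prob (@ltr01 R); apply.
Qed.

(** C(x, .) is the distribution function of the measure P(U <= x, V in A). This measure is dominated
    by the uniform law of V, hence has a density, and Lebesgue differentiation applies. *)
Lemma copula_derivable2 (x : R) :
  {ae leb, forall y : R, derivable (C x : R -> R) (y : R) (1 : R)}.
Proof.
have mD : measurable [set t | U t <= x].
  by apply: measurable_set_ler => //; exact: measurable_funPT.
have Dfin : (P0 [set t | (U t <= x)%R] < +oo)%E.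
  by rewrite -ge0_fin_numE ?fin_num_measure.
pose P : {finite_measure set T0 -> \bar R} := mfrestr mD Dfin.
pose nu := real_law P (@measurable_funPT _ _ _ _ V).
have [r nur] : exists r, has_density nu r.
  apply: density_exists => A mA A0.
  apply/eqP; rewrite eq_le measure_ge0 andbT -(copula_null2 mA A0).
  rewrite /nu /real_law /= /mfrestr /mrestr; apply: measureIl => //.
  exact: measurable_funPTI.
have CE : C x = fun z => fine (\int[leb]_(t in `]-oo, z]) (r t)%:E)%E.
  apply/funext => z; rewrite -(density_ray z nur).
  rewrite -hUV /joint_cdf /nu /real_law /= /mfrestr /mrestr.
  congr (fine (P0 _)); apply/seteqP; split => t /=; rewrite in_itv.
    by move=> [].
  by move=> [].
have [_ ir _] := nur.
rewrite CE; apply: filterS (ae_is_derive_integral ir).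
  exact: (ae_filter_ringOfSetsType leb).
by move=> y [].
Qed.

End conditional_density.

(** * The conditional law of U_{m:n} given V_{k:n}, for fixed x *)

Section order_stat_density.
Variables (R : realType) (C : R -> R -> R) (d0 : measure_display).
Variables (T0 : measurableType d0) (P0 : probability T0 R).
Variables (U V : {RV P0 >-> R}).
Hypotheses (hC : copula C) (hUV : joint_cdf P0 U V = C).
Variables (n : nat) (d : measure_display) (T : measurableType d).
Variables (P : probability T R) (Us Vs : 'I_n -> {RV P >-> R}).
Hypothesis hcopy : forall i : 'I_n,
  same_law P P0 (fun t => (Us i t, Vs i t)) (fun t => (U t, V t)).
Hypothesis hindep :
  mutually_independent P (fun (i : 'I_n) t => (Us i t, Vs i t)).
Variables (k m : nat) (hk : (1 <= k <= n)%N) (hm : (1 <= m <= n)%N).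
Variable kappa : R.-pker R ~> R.
Hypothesis hkappa : cond_distribution P
  (order_stat (fun i => Us i : T -> R) m)
  (order_stat (fun i => Vs i : T -> R) k) kappa.
Local Notation leb := (@lebesgue_measure R).
Local Notation Um := (order_stat (fun i => Us i : T -> R) m).
Local Notation Vk := (order_stat (fun i => Vs i : T -> R) k).

Let mVk : measurable_fun [set: T] Vk.
Proof. by apply: measurable_order_stat => // i; exact: measurable_funPT. Qed.

(** V_{k:n} always equals one of the V_i, so the event lies in a finite union of null events. *)
Lemma order_stat_null (A : set (measurableTypeR R)) : measurable A ->
  leb A = 0%E -> P (Vk @^-1` A) = 0%E.
Proof.
move=> mA A0.
have mVs i : measurable (Vs i @^-1` A).
  exact: measurable_funPTI.
have Vs0 i : P (Vs i @^-1` A) = 0%E.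
  have := hcopy i (measurableX measurableT mA).
  have -> : (fun t => (Us i t, Vs i t)) @^-1` (setT `*` A) = Vs i @^-1` A.
    by apply/seteqP; split => t //= [].
  have -> : (fun t => (U t, V t)) @^-1` (setT `*` A) = V @^-1` A.
    by apply/seteqP; split => t //= [].
  by move=> ->; exact: (copula_null2 hC hUV mA A0).
have sub : Vk @^-1` A `<=` \big[setU/set0]_(i < n) (Vs i @^-1` A).
  move=> t /= At.
  have : Vk t \in [seq Vs i t | i <- enum 'I_n].
    rewrite -(mem_sort <=%R) mem_nth// size_sort size_map size_enum_ord.
    by case/andP: hk => k0 kn; rewrite prednK.
  by move=> /mapP[i _ e]; rewrite (bigD1 i)//; left; rewrite /= -e.
have mVkA : measurable (Vk @^-1` A).
  by rewrite -[X in measurable X]setTI; exact: mVk.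
have [mcup cup0] : measurable (\big[setU/set0]_(i < n) (Vs i @^-1` A)) /\
    P (\big[setU/set0]_(i < n) (Vs i @^-1` A)) = 0%E.
  elim/big_ind : _ => [|X Y [mX X0] [mY Y0]|i _]; split => //.
    exact: measurableU.
  apply/eqP; rewrite eq_le measure_ge0 andbT.
  have h : (P X + P Y <= 0)%E by rewrite X0 Y0 adde0.
  exact: le_trans (measureU2 P mX mY) h.
apply/eqP; rewrite eq_le measure_ge0 andbT -[X in (_ <= X)%E]cup0.
by apply: le_measure => //; rewrite inE.
Qed.

Let nu := real_law P mVk.

Let joint (z x : R) := fine (P ((Um @^-1` `]-oo, x]) `&` (Vk @^-1` `]-oo, z]))).

Let jointE z x : 0 <= x <= 1 -> 0 <= z <= 1 ->
  joint z x = upper_sum n k m (pair_pgf (C x z) x z ^+ n).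
Proof.
move=> x01 z01.
rewrite -(order_stats_cdf hC hUV hcopy hindep)//; congr (fine (P _)).
apply/seteqP; split => t /=; rewrite !in_itv /= !order_stat_le//.
  by move=> [-> ->].
by move=> /andP[-> ->].
Qed.

Let margE x z : 0 <= x <= 1 -> 0 <= z <= 1 ->
  fine (P (Vk @^-1` `]-oo, z])) = upper_sum n k 0 (pair_pgf (C x z) x z ^+ n).
Proof.
move=> x01 z01.
rewrite -(order_stats_cdf hC hUV hcopy hindep)//.
congr (fine (P _)).
by apply/seteqP; split => t /=; rewrite !in_itv /= order_stat_le// leq0n.
Qed.

Let kappa_le1 x y : (kappa y `]-oo, x]%classic <= 1)%E.
Proof.
apply: (@le_trans _ _ (kappa y [set: R])); last by rewrite prob_kernel.
by apply: le_measure => //; rewrite inE.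
Qed.

Let measurable_kappa x :
  measurable_fun [set: measurableTypeR R] (fun y => kappa y `]-oo, x]%classic).
Proof.
have h : measurable_fun [set: R] (fun y => kappa y `]-oo, x]%classic).
  by apply: (measurable_kernel kappa); exact: measurable_itv.
exact: h.
Qed.

Let joint_integral z x :
  P ((Um @^-1` `]-oo, x]) `&` (Vk @^-1` `]-oo, z])) =
  (\int[nu]_(y in `]-oo, z]) kappa y `]-oo, x]%classic)%E.
Proof.
rewrite hkappa//.
(* The pushforward in [cond_distribution] and [nu] are one law on two displays; both integrals are
   pulled back to [T] and compared there. *)
rewrite (ge0_integral_pushforward mVk)//; last first.
  by apply: measurable_funTS; apply: measurable_kernel.
symmetry.
have mVkR : measurable_fun [set: T] (Vk : T -> measurableTypeR R) by [].
rewrite -[RHS](ge0_integral_pushforward mVkR)//.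
by apply: measurable_funTS; exact: measurable_kappa.
Qed.

(** With r the density of V_{k:n}, the distribution function of V_{k:n} and the joint one have
    almost everywhere the derivatives r and P(U_{m:n} <= x | V_{k:n} = y) r. Comparing both with
    [upper_sum_is_derive] eliminates r and the binomial constant, without dividing by powers of y or
    1 - y. *)
Lemma cond_density_identity x : 0 <= x <= 1 ->
  {ae leb, forall y : R, 0 < y < 1 ->
    exists2 c : R, is_derive (y : R) (1 : R) (C x : R -> R) c &
    fine (kappa y `]-oo, x]%classic) * (y ^+ k.-1 * (1 - y) ^+ (n - k)) =
    \sum_(m <= i < n.+1) ((c *: 'X + (1 - c)%:P) *
       (below_pgf (C x y) y ^+ k.-1 * above_pgf (C x y) x y ^+ (n - k)))`_i}.
Proof.
move=> x01.
have [r nur] : exists r, has_density nu r.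
  by apply: density_exists => A mA A0; exact: order_stat_null.
have [r0 ir nuE] := nur.
pose g y := fine (kappa y `]-oo, x]%classic) * r y.
have kfin y : (fine (kappa y `]-oo, x]%classic))%:E = kappa y `]-oo, x]%classic.
  by rewrite fineK// ge0_fin_numE// (le_lt_trans (kappa_le1 x y))// ltry.
have ig : leb.-integrable [set: R] (EFin \o g).
  have mr := measurable_int _ ir; apply: le_integrable ir => //.
    apply/measurable_EFinP; apply: measurable_funM.
      apply: measurableT_comp => //; exact: measurable_kappa.
    exact/measurable_EFinP.
  move=> y _; rewrite /= lee_fin /g normrM ler_piMl// ger0_norm.
    by rewrite -lee_fin kfin.
  by rewrite fine_ge0.
apply: filterS3 (ae_is_derive_integral ir) (ae_is_derive_integral ig)
  (copula_derivable2 hC hUV x).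
  exact: (ae_filter_ringOfSetsType leb).
have rE z : fine (\int[leb]_(t in `]-oo, z]) (r t)%:E)%E =
    fine (P (Vk @^-1` `]-oo, z])) by rewrite -(density_ray z nur).
have gE z : fine (\int[leb]_(t in `]-oo, z]) (g t)%:E)%E = joint z x.
  rewrite /joint joint_integral nuE//; congr fine; apply: eq_integral => t _.
  by rewrite /g EFinM kfin.
move=> y hr hg hCx y01.
have hc : is_derive (y : R) (1 : R) (C x : R -> R) (derive1 (C x : R -> R) y).
  by rewrite derive1E; exact: DeriveDef.
exists (derive1 (C x : R -> R) y) => //.
(* The polynomial formulas hold only on [0, 1]; around an interior point they hold on a
   neighbourhood, which is enough to differentiate them. *)
have near01 : \forall z \near y, 0 <= z <= 1.
  have /near_in_itvoo : y \in `]0, 1[ by rewrite in_itv.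
  by apply: filterS => z; rewrite in_itv /= => /andP[/ltW -> /ltW ->].
(* To be used with [j = 0] for the law of V_{k:n} and with [j = m] for the joint law. *)
have cmp (q : R -> R) j dq : is_derive (y : R) (1 : R) q dq ->
    (\forall z \near y, q z = upper_sum n k j (pair_pgf (C x z) x z ^+ n)) ->
    dq = (n * 'C(n.-1, k.-1))%:R * \sum_(j <= i < n.+1)
      ((derive1 (C x : R -> R) y *: 'X + (1 - derive1 (C x : R -> R) y)%:P) *
       (below_pgf (C x y) y ^+ k.-1 * above_pgf (C x y) x y ^+ (n - k)))`_i.
  move=> hq near_q.
  have hU := upper_sum_is_derive x j hc hk.
  have [_ <-] := hU; have [_ <-] := near_eq_is_derive near_q hq.
  by [].
have er := cmp _ 0%N _ hr (filterS (fun z z01 =>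
  etrans (rE z) (margE x01 z01)) near01).
have eg := cmp _ m _ hg (filterS (fun z z01 =>
  etrans (gE z) (jointE x01 z01)) near01).
clear cmp.
set c := derive1 _ _ in er eg *.
set W := below_pgf _ _ ^+ _ * _ in er eg *.
have sW : (size W <= n)%N.
  case/andP: hk => k0 kn; rewrite (leq_trans (size_affineX_expM _ _ _ _ _ _))//.
  by rewrite -addSn prednK// subnKC.
have W1 : W.[1] = y ^+ k.-1 * (1 - y) ^+ (n - k).
  rewrite /W /below_pgf /above_pgf !hornerE /=; congr (_ ^+ _ * _ ^+ _).
    by ring.
  by ring.
have bin_neq0 : (n * 'C(n.-1, k.-1))%:R != 0 :> R.
  rewrite pnatr_eq0 muln_eq0 negb_or -!lt0n bin_gt0.
  by case/andP: hk => k0 kn; rewrite (leq_trans k0 kn) -!subn1 leq_sub2r.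
apply: (mulfI bin_neq0).
by rewrite -W1 -(sum_coef_affineXM0 c sW) mulrCA -er -eg.
Qed.

End order_stat_density.

(** * Joint measurability in [(x, y)] *)

Section measurable_coefficients.
Variables (R : realType) (d : measure_display) (Z : measurableType d).

Definition coef_measurable (q : Z -> {poly R}) :=
  forall i, measurable_fun [set: Z] (fun z => (q z)`_i).

Lemma coef_measurable_affine (a b : Z -> R) :
  measurable_fun [set: Z] a -> measurable_fun [set: Z] b ->
  coef_measurable (fun z => a z *: 'X + (b z)%:P).
Proof.
move=> ma mb i.
under eq_fun do rewrite coefD coefZ coefX coefC.
case: (i == 0)%N.
  by apply: measurable_funD => //; apply: measurable_funM.
by apply: measurable_funD => //; apply: measurable_funM.
Qed.

Lemma coef_measurableM (p q : Z -> {poly R}) :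
  coef_measurable p -> coef_measurable q ->
  coef_measurable (fun z => p z * q z).
Proof.
move=> mp mq i; under eq_fun do rewrite coefM.
by apply: measurable_sum => j; exact: measurable_funM.
Qed.

Lemma coef_measurableX (q : Z -> {poly R}) l :
  coef_measurable q -> coef_measurable (fun z => q z ^+ l).
Proof.
move=> mq; elim: l => [|l IHl]; first
  by move=> i; exact: (measurable_cst (1 : {poly R})`_i).
have -> : (fun z => q z ^+ l.+1) = (fun z => q z * q z ^+ l).
  by apply/funext => z; rewrite exprS.
exact: coef_measurableM.
Qed.

End measurable_coefficients.

(** The value at (u, v) is the probability of the section at (u, v) of one measurable subset of the
    product of the plane with [T]. *)
Lemma measurable_joint_cdf (R : realType) (d : measure_display)
    (T : measurableType d) (P : probability T R) (U V : {RV P >-> R}) :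
  measurable_fun [set: R * R] (fun z : R * R => joint_cdf P U V z.1 z.2).
Proof.
pose A := [set w : (R * R) * T | U w.2 <= w.1.1] `&`
          [set w : (R * R) * T | V w.2 <= w.1.2].
have mle (X : {RV P >-> R}) (f : R * R -> R) : measurable_fun [set: R * R] f ->
    measurable [set w : (R * R) * T | X w.2 <= f w.1].
  move=> mf; apply: measurable_set_ler.
    by apply: (measurableT_comp (@measurable_funPT _ _ _ _ X)).
  by apply: (measurableT_comp mf).
have mA : measurable A by apply: measurableI; apply: mle.
have := measurable_fun_xsection P mA.
move=> /(measurableT_comp (@fine_measurable R _ measurableT)).
congr measurable_fun; apply/funext => z /=; congr (fine (P _)).
by apply/seteqP; split => t; rewrite /xsection /= inE.
Qed.

Section measurable_kernel_cdf.
Variables (R : realType) (kappa : R.-pker R ~> R).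

Let kappa2 (z : R * R) : {measure set R -> \bar R} := kappa z.2.

Let measurable_kappa2 U : measurable U ->
  measurable_fun [set: R * R] (kappa2 ^~ U).
Proof.
move=> mU; exact: (measurableT_comp (measurable_kernel kappa U mU)).
Qed.

HB.instance Definition _ := isKernel.Build _ _ _ _ R kappa2 measurable_kappa2.

Let kappa2T z : kappa2 z [set: R] = 1%E.
Proof. exact: prob_kernel. Qed.

HB.instance Definition _ := Kernel_isProbability.Build _ _ _ _ _ kappa2 kappa2T.

(** The ray moves with x while the measure moves with y. Seen as the kernel [kappa2] on the plane,
    which ignores x, the measure is applied to sections of one measurable set. *)
Lemma measurable_kernel_cdf :
  measurable_fun [set: R * R]
    (fun z : R * R => fine (kappa z.2 `]-oo, z.1]%classic)).
Proof.
pose A := [set w : (R * R) * R | w.2 <= w.1.1].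
have mA : measurable A.
  by apply: measurable_set_ler => //; apply: measurableT_comp.
have := @measurable_fun_xsection_finite_kernel _ _ _ _ R kappa2 A.
rewrite inE => /(_ mA) /(measurableT_comp (@fine_measurable R _ measurableT)).
congr measurable_fun; apply/funext => z /=; congr fine; rewrite /kappa2.
congr (kappa _ _).
by apply/seteqP; split => t; rewrite /xsection /= inE in_itv.
Qed.

End measurable_kernel_cdf.

(** * Derivability in the second variable as a Borel condition *)

Section rational_derivative.
Variables (R : realType) (C : R -> R -> R).
Hypothesis mC : measurable_fun [set: R * R] (fun z : R * R => C z.1 z.2).
Hypothesis cC : forall x, continuous (C x : R -> R).

Definition diff_quot (h : R) (z : R * R) : R :=
  h^-1 * (C z.1 (h + z.2) - C z.1 z.2).

(** A Borel function defined on the whole plane that agrees with dC/dy wherever this derivative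
    exists; increments 1/(j+1) suffice for that. *)
Definition limsup_quot (z : R * R) : R :=
  fine (limn_esup (fun j => (diff_quot j.+1%:R^-1 z)%:E)).

Definition quot_close (i N : nat) (s : rat) : set (R * R) :=
  [set z | 0 < `|ratr s : R| < N.+1%:R^-1 ->
           `|diff_quot (ratr s) z - limsup_quot z| <= i.+1%:R^-1].

(* Increments are restricted to rationals so that the set is Borel; by
   continuity of [C x] this is still derivability in the second variable. *)
Definition rational_derivable : set (R * R) :=
  \bigcap_i \bigcup_N \bigcap_s quot_close i N s.

Lemma measurable_diff_quot h : measurable_fun [set: R * R] (diff_quot h).
Proof.
apply: measurable_funM => //; apply: measurable_funB => //.
have mg : measurable_fun [set: R * R] (fun z : R * R => (z.1, h + z.2)).
  by apply: measurable_fun_pair => //=; apply: measurable_funD.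
exact: (measurableT_comp mC mg).
Qed.

Lemma measurable_limsup_quot : measurable_fun [set: R * R] limsup_quot.
Proof.
apply: (measurableT_comp (@fine_measurable R _ measurableT)).
apply: measurable_fun_limn_esup => j; apply/measurable_EFinP.
exact: measurable_diff_quot.
Qed.

Lemma measurable_rational_derivable : measurable rational_derivable.
Proof.
apply: bigcapT_measurable => i; apply: bigcupT_measurable => N.
have mq s : measurable (quot_close i N s).
  have [sN|sN] := boolP (0 < `|ratr s : R| < N.+1%:R^-1); last first.
    have -> : quot_close i N s = setT.
      by apply/seteqP; split => // z _ /(negP sN).
    exact: measurableT.
  have -> : quot_close i N s =
      [set z | `|diff_quot (ratr s) z - limsup_quot z| <= i.+1%:R^-1].
    by apply/seteqP; split => z hz; [exact: hz sN | move=> _].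
  apply: measurable_set_ler => //; apply: measurableT_comp => //.
  apply: measurable_funB; first exact: measurable_diff_quot.
  exact: measurable_limsup_quot.
(* The rationals are enumerated by [unpickle]; integers that code no rational contribute the whole
   plane. *)
have -> : \bigcap_s quot_close i N s = \bigcap_(j : nat)
    (if unpickle j is Some s then quot_close i N s else setT).
  apply/seteqP; split => z /= hz.
    by move=> j _; case: (unpickle j) => // s; exact: hz.
  by move=> s _; have := hz (pickle s) Logic.I; rewrite pickleK.
apply: bigcapT_measurable => j.
by case: (unpickle j) => [s|]; [exact: mq | exact: measurableT].
Qed.

(** The difference quotient is continuous in h away from 0. If it were far from the limit at some
    small real h, it would be so on an open set around h, hence at a small nonzero rational. *)
Lemma rational_derivableP x y : rational_derivable (x, y) ->
  is_derive (y : R) (1 : R) (C x : R -> R) (limsup_quot (x, y)).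
Proof.
move=> hxy; set l := limsup_quot (x, y).
suff h : (fun h : R =>
    h^-1 *: ((C x \o shift y) (h *: (1 : R)) - C x y)) @ 0^' --> l.
  apply: DeriveDef; first by apply/cvg_ex; exists l.
  by apply/cvg_lim => //; exact: Rhausdorff.
have quotE h : h^-1 *: ((C x \o shift y) (h *: (1 : R)) - C x y) =
    diff_quot h (x, y).
  by rewrite /diff_quot /= /GRing.scale /= mulr1.
under eq_fun do rewrite quotE.
have cq h : h != 0 -> {for h, continuous (fun h => diff_quot h (x, y))}.
  move=> h0; rewrite /diff_quot /=; apply: cvgM; first exact: cvgV.
  apply: cvgB; last exact: cvg_cst.
  apply: (@continuous_comp _ _ _ (fun h => h + y) (C x)); last exact: cC.
  by apply: cvgD; [exact: cvg_id | exact: cvg_cst].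
apply/cvgrPdist_le => e e0.
have [i ie] : exists i : nat, i.+1%:R^-1 < e.
  exists (Num.truncn e^-1); rewrite invf_plt ?posrE//.
  exact: truncnS_gt.
have [N _ hN] := hxy i Logic.I.
near=> h.
have h0 : h != 0 by near: h; exact: nbhs_dnbhs_neq.
have hlt : `|h| < N.+1%:R^-1.
  by near: h; apply: dnbhs0_lt; rewrite invr_gt0.
rewrite leNgt; apply/negP => far.
pose bad := [set h' | [/\ e < `|l - diff_quot h' (x, y)|,
  `|h'| < N.+1%:R^-1 & h' != 0]].
have : nbhs h bad.
  near=> h'; split; near: h'.
  - have cf : {for h, continuous (fun h => `|l - diff_quot h (x, y)|)}.
      by apply: cvg_norm; apply: cvgB; [exact: cvg_cst | exact: cq].
    exact: (cvgr_gt _ cf _ far).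
  - exact: (cvgr_lt _ (@norm_continuous _ _ h) _ hlt).
  - by apply: open_nbhs_nbhs; split => //; exact: open_neq.
rewrite nbhsE => -[B [oB Bh] subB].
have [h' [/subB[far' lt' nz'] [s _ sh]]] := dense_rat (ex_intro _ h Bh) oB.
have := hN s Logic.I; rewrite /quot_close /= sh normr_gt0 nz' lt' => /(_ isT).
rewrite leNgt => /negP; apply.
by rewrite distrC (lt_trans ie).
Unshelve. all: by end_near. Qed.

Lemma rational_derivable_of x y c :
  is_derive (y : R) (1 : R) (C x : R -> R) c ->
  limsup_quot (x, y) = c /\ rational_derivable (x, y).
Proof.
move=> hc.
have quotE h : h^-1 *: ((C x \o shift y) (h *: (1 : R)) - C x y) =
    diff_quot h (x, y).
  by rewrite /diff_quot /= /GRing.scale /= mulr1.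
have cvgq : (fun h => diff_quot h (x, y)) @ 0^' --> c.
  under eq_fun do rewrite -quotE.
  by have [d dc] := hc; rewrite -dc; exact: d.
have lc : limsup_quot (x, y) = c.
  rewrite /limsup_quot.
  have h : (diff_quot j.+1%:R^-1 (x, y))%:E @[j --> \oo] --> c%:E.
    apply: cvg_EFin; first exact: nearW.
    apply/cvgrPdist_le => e e0.
    have [del /= del0 hdel] := (cvgrPdist_le _ _).1 cvgq e e0.
    near=> j; apply: hdel; last by rewrite invr_neq0.
    rewrite /= sub0r normrN ger0_norm//; near: j.
    exact: (cvgr_lt _ (@cvg_harmonic R) _ del0).
  by rewrite (cvg_limn_einf_sup h).2.
split => // i _.
have : \forall h \near 0^', `|c - diff_quot h (x, y)| <= i.+1%:R^-1.
  by move/cvgrPdist_le : cvgq; apply; rewrite invr_gt0.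
move=> -[e /= e0 he].
(* This N satisfies 1/(N+1) < e, so the admissible rationals fall within the radius [e]. *)
exists (Num.truncn e^-1) => // s _; rewrite /quot_close /= lc => /andP[s0 sN].
rewrite distrC; apply: he; last by rewrite -normr_gt0.
rewrite /= sub0r normrN (lt_trans sN)// invf_plt ?posrE//.
exact: truncnS_gt.
Unshelve. all: by end_near. Qed.

End rational_derivative.

(** * From fixed x to almost every (x, y) *)

Section product_ae.
Variables (R : realType) (C : R -> R -> R) (d0 : measure_display).
Variables (T0 : measurableType d0) (P0 : probability T0 R).
Variables (U V : {RV P0 >-> R}).
Hypotheses (hC : copula C) (hUV : joint_cdf P0 U V = C).
Local Notation leb := (@lebesgue_measure R).

(** The increment is P(U <= x, b < V <= a), at most P(b < V <= a), and the uniform density is at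
    most 1. *)
Lemma copula_increment2 x a b : b <= a -> `|C x a - C x b| <= a - b.
Proof.
move=> ba.
have mle (X : {RV P0 >-> R}) z : measurable [set t | X t <= z].
  by apply: measurable_set_ler => //; exact: measurable_funPT.
pose Q z := [set t | U t <= x /\ V t <= z].
have mQ z : measurable (Q z) by apply: measurableI; exact: mle.
have Qba : Q b `<=` Q a by move=> t [Ux Vb]; split => //; exact: le_trans ba.
have inc : C x a - C x b = fine (P0 (Q a `\` Q b)).
  rewrite -hUV /joint_cdf -/(Q a) -/(Q b).
  have := measureDI P0 (mQ a) (mQ b); rewrite (setIidr Qba) => ->.
  rewrite fineD ?addrK// fin_num_measure//; exact: measurableD.
rewrite inc ger0_norm ?fine_ge0// -lee_fin fineK ?fin_num_measure//; last first.
  exact: measurableD.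
have mV : measurable (V @^-1` `]b, a]%classic) by exact: measurable_funPTI.
apply: (@le_trans _ _ (P0 (V @^-1` `]b, a]%classic))).
  apply: le_measure; rewrite ?inE//; first exact: measurableD.
  move=> t [[Ux Va] nQb]; rewrite /= in_itv /= Va andbT ltNge.
  by apply/negP => Vb; exact: nQb.
rewrite (copula_law2 hC hUV)// /uniform_prob.
apply: (@le_trans _ _ (\int[leb]_(t in `]b, a]) (cst 1%E t))%E).
  apply: ge0_le_integral => //.
  - by move=> t _; rewrite lee_fin uniform_pdf_ge0.
  - apply/measurable_EFinP; apply: measurable_funTS.
    exact: measurable_uniform_pdf.
  - move=> t _; rewrite lee_fin /uniform_pdf.
    by case: ifP; rewrite ?subr0 ?invr1.
rewrite integral_cst//= mul1e lebesgue_measure_itv /= lte_fin.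
by case: ltP => // _; rewrite lee_fin subr_ge0.
Qed.

Lemma copula_continuous2 x : continuous (C x : R -> R).
Proof.
move=> y; apply/cvgrPdist_le => e e0; near=> z.
apply: (@le_trans _ _ `|y - z|); last first.
  by near: z; apply: cvgr_dist_le => //; exact: cvg_id.
have [yz|/ltW zy] := leP y z.
  by rewrite distrC (le_trans (copula_increment2 x yz))// distrC ler_norm.
by rewrite (le_trans (copula_increment2 x zy))// ler_norm.
Unshelve. all: by end_near. Qed.

Lemma measurable_copula :
  measurable_fun [set: R * R] (fun z : R * R => C z.1 z.2).
Proof. by rewrite -hUV; exact: measurable_joint_cdf. Qed.

End product_ae.

(** The product measure of the complement is the integral of the measures of its sections, all
    zero. *)
Lemma ae_product_of_sections (R : realType) (B : set (R * R)) :
  measurable B ->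
  (forall x, {ae (@lebesgue_measure R), forall y : R, B (x, y)}) ->
  {ae (@lebesgue_measure R \x @lebesgue_measure R)%E, forall z : R * R, B z}.
Proof.
move=> mB hB; exists (~` B); split => //.
  exact: measurableC.
rewrite /product_measure1 integral0_eq// => x _ /=.
have mx : @measurable _ (measurableTypeR R) (xsection (~` B) x).
  by apply: measurable_xsection; exact: measurableC.
apply: (measure_negligible mx).
have := hB x; congr negligible; apply/seteqP; split => y /=.
  by rewrite /xsection /= inE.
by rewrite /xsection /= inE.
Qed.

Section ae_cond_identity.
Variables (R : realType) (C : R -> R -> R) (d0 : measure_display).
Variables (T0 : measurableType d0) (P0 : probability T0 R).
Variables (U V : {RV P0 >-> R}).
Hypotheses (hC : copula C) (hUV : joint_cdf P0 U V = C).
Variables (n : nat) (d : measure_display) (T : measurableType d).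
Variables (P : probability T R) (Us Vs : 'I_n -> {RV P >-> R}).
Hypothesis hcopy : forall i : 'I_n,
  same_law P P0 (fun t => (Us i t, Vs i t)) (fun t => (U t, V t)).
Hypothesis hindep :
  mutually_independent P (fun (i : 'I_n) t => (Us i t, Vs i t)).
Variables (k m : nat) (hk : (1 <= k <= n)%N) (hm : (1 <= m <= n)%N).
Variable kappa : R.-pker R ~> R.
Hypothesis hkappa : cond_distribution P
  (order_stat (fun i => Us i : T -> R) m)
  (order_stat (fun i => Vs i : T -> R) k) kappa.
Local Notation leb := (@lebesgue_measure R).

(** The derivative is a free parameter [c]: [limsup_quot] takes its place to prove measurability,
    [derive1] in the conclusion. *)
Definition cond_identity (c x y : R) : Prop :=
  fine (kappa y `]-oo, x]%classic) * (y ^+ k.-1 * (1 - y) ^+ (n - k)) =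
  \sum_(m <= i < n.+1) ((c *: 'X + (1 - c)%:P) *
    (below_pgf (C x y) y ^+ k.-1 * above_pgf (C x y) x y ^+ (n - k)))`_i.

Let mC := measurable_copula hUV.

Lemma measurable_cond_identity (c : R * R -> R) :
  measurable_fun [set: R * R] c ->
  measurable [set z : R * R | cond_identity (c z) z.1 z.2].
Proof.
move=> mc.
have m1y : measurable_fun [set: R * R] (fun z : R * R => 1 - z.2).
  by apply: measurable_funB.
have mxC : measurable_fun [set: R * R] (fun z : R * R => z.1 - C z.1 z.2).
  by apply: measurable_funB.
have mq : coef_measurable (fun z : R * R => (c z *: 'X + (1 - c z)%:P) *
   (below_pgf (C z.1 z.2) z.2 ^+ k.-1 *
    above_pgf (C z.1 z.2) z.1 z.2 ^+ (n - k))).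
  apply: coef_measurableM.
    by apply: coef_measurable_affine => //; exact: measurable_funB.
  apply: coef_measurableM; apply: coef_measurableX.
    by apply: coef_measurable_affine => //; exact: measurable_funB.
  by apply: coef_measurable_affine => //; exact: measurable_funB.
have -> : [set z : R * R | cond_identity (c z) z.1 z.2] = [set z : R * R |
    fine (kappa z.2 `]-oo, z.1]%classic) *
      (z.2 ^+ k.-1 * (1 - z.2) ^+ (n - k)) ==
    \sum_(m <= i < n.+1) ((c z *: 'X + (1 - c z)%:P) *
      (below_pgf (C z.1 z.2) z.2 ^+ k.-1 *
       above_pgf (C z.1 z.2) z.1 z.2 ^+ (n - k)))`_i].
  by apply/seteqP; split => z /= /eqP.
apply: measurable_set_bool; apply: measurable_fun_eqr.
  apply: measurable_funM; first exact: measurable_kernel_cdf.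
  by apply: measurable_funM; apply: measurable_funX.
by apply: measurable_sum => i; exact: mq.
Qed.

Lemma ae_cond_identity :
  {ae (leb \x leb)%E, forall z : R * R, 0 <= z.1 <= 1 -> 0 <= z.2 <= 1 ->
    [/\ 0 < z.2 < 1, derivable (C z.1 : R -> R) (z.2 : R) (1 : R) &
        cond_identity (derive1 (C z.1 : R -> R) z.2) z.1 z.2]}.
Proof.
pose good := [set z : R * R | 0 < z.2 < 1] `&` rational_derivable C `&`
  [set z | cond_identity (limsup_quot C z) z.1 z.2].
pose box := [set z : R * R | 0 <= z.1 <= 1] `&` [set z : R * R | 0 <= z.2 <= 1].
have mgood : measurable good.
  apply: measurableI; last first.
    by apply: measurable_cond_identity; exact: measurable_limsup_quot.
  apply: measurableI; last exact: measurable_rational_derivable.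
  by apply: measurable_set_bool; apply: measurable_and;
    apply: measurable_fun_ltr.
have mbox : measurable box.
  by apply: measurableI; apply: measurable_set_bool; apply: measurable_and;
    apply: measurable_fun_ler.
have : {ae (leb \x leb)%E, forall z : R * R, (~` box `|` good) z}.
  apply: ae_product_of_sections => [|x].
    by apply: measurableU => //; exact: measurableC.
  have [x01|x01] := boolP (0 <= x <= 1); last first.
    apply: aeW => y; left => -[/=].
    by rewrite (negbTE x01).
  have ae_neq (a : R) : {ae leb, forall y : R, y != a}.
    exists [set a]; split; first exact: measurable_set1.
      exact: lebesgue_measure_set1.
    by move=> y /= /negP; rewrite negbK => /eqP.
  apply: filterS3 (ae_neq 0) (ae_neq 1)
    (cond_density_identity hC hUV hcopy hindep hk hm hkappa x01).
    exact: (ae_filter_ringOfSetsType leb).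
  move=> y y0 y1 hy.
  have [y01|y01] := boolP (0 <= y <= 1); last first.
    by left => -[_ /=]; rewrite (negbTE y01).
  have y01' : 0 < y < 1.
    by rewrite lt_neqAle eq_sym y0 lt_neqAle y1; exact: y01.
  right; have [c hc hid] := hy y01'.
  have [lc rd] := rational_derivable_of hc.
  by split; [split|]; rewrite //= lc.
apply: filterS; first exact: (ae_filter_ringOfSetsType (leb \x leb)%E).
move=> [x y] /= [nbox x01 y01|[[y01 rd] hid] x01 yy01]; first by case: nbox.
have hd := rational_derivableP (copula_continuous2 hC hUV) rd.
by split => //; rewrite derive1E; case: hd => _ ->.
Qed.

End ae_cond_identity.

(** * The law of the count of points in [[0, x]] *)

Section count_law.
Variables (R : realType) (d : measure_display) (T : measurableType d).
Variables (P : probability T R) (k l : nat).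
Variables (X : 'I_k -> {RV P >-> R}) (Y : 'I_l -> {RV P >-> R}).
Variables (x a b : R).
Hypothesis hind : mutually_independent P
  (join_families (fun i => X i : T -> R) (fun j => Y j : T -> R)).
Hypothesis hX : forall i, fine (P (X i @^-1` `[0, x]%classic)) = a.
Hypothesis hY : forall j, fine (P (Y j @^-1` `[0, x]%classic)) = b.
Hypothesis k0 : (0 < k)%N.

(** For k > 0, the generating function of a sum of k - 1 Bernoulli(a) and l Bernoulli(b) variables,
    all independent. *)
Definition count_pgf (k l : nat) (a b : R) : {poly R} :=
  (a *: 'X + (1 - a)%:P) ^+ k.-1 * (b *: 'X + (1 - b)%:P) ^+ l.

Let Z := join_families (fun i => X i : T -> R) (fun j => Y j : T -> R).
(** The first family has k members but only k - 1 of them enter the count; the one of index k - 1 is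
    masked. *)
Let counted (s : 'I_k + 'I_l) : bool :=
  if s is inl i then (i < k.-1)%N else true.
Let inside s t : bool := Z s t \in `[0, x].
Let count (s : {ffun 'I_k + 'I_l -> bool}) :=
  (\sum_i (counted i && s i : nat))%N.
Let p (s : 'I_k + 'I_l) (c : bool) : R :=
  let q := if s is inl _ then a else b in if c then q else 1 - q.

Let measurable_Z s : measurable_fun [set: T] (Z s).
Proof. by case: s => i; exact: measurable_funPT. Qed.

Let measurable_inside s c : measurable (inside s @^-1` [set c]).
Proof.
have -> : inside s = fun t => (0 <= Z s t) && (Z s t <= x).
  by apply/funext => t; rewrite /inside in_itv.
by apply: measurable_preimage_bool; apply: measurable_and;
  apply: measurable_fun_ler => //; exact: measurable_Z.
Qed.

Let prob_inside s c : fine (P (inside s @^-1` [set c])) = p s c.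
Proof.
have ht : fine (P (inside s @^-1` [set true])) = p s true.
  by case: s => i; rewrite /p /= -?(hX i) -?(hY i).
case: c => //.
have -> : inside s @^-1` [set false] = ~` (inside s @^-1` [set true]).
  by apply/seteqP; split => t /=; [move=> -> | move=> /negP/negbTE].
by rewrite probability_setC// fineB ?fin_num_measure// ht.
Qed.

Let prob_state (s : {ffun 'I_k + 'I_l -> bool}) :
  fine (P [set t | forall i, inside i t = s i]) = \prod_i p i (s i).
Proof.
pose A i : set R := if s i then `[0, x]%classic else ~` `[0, x]%classic.
have mA i : measurable (A i).
  by rewrite /A; case: (s i); [|apply: measurableC]; exact: measurable_itv.
have AE i : inside i @^-1` [set s i] = Z i @^-1` A i.
  rewrite /A; case: (s i); apply/seteqP; split => t //=.
    by rewrite /inside => ->.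
  by move=> /negP/negbTE.
transitivity (fine (P (\bigcap_(i in [set` [set: 'I_k + 'I_l]%SET])
    Z i @^-1` A i))).
  congr (fine (P _)); apply/seteqP; split => t /= h i.
    by move=> _; rewrite -AE; exact: h.
  have : (Z i @^-1` A i) t by apply: h; rewrite /= inE.
  by rewrite -AE.
rewrite hind//; apply: eq_big => i; first by rewrite inE.
by move=> _; rewrite -AE prob_inside.
Qed.

Let count_leE t : count_le (fun i => X i : T -> R) (fun j => Y j : T -> R) x t =
  (count [ffun i => inside i t])%:R.
Proof.
rewrite /count_le /count natr_sum big_sumType /=; congr (_ + _).
  rewrite [LHS]big_mkcond; apply: eq_bigr => i _; rewrite ffunE /inside indicE.
  by case: ifP => _ //=; rewrite mem_setE.
by apply: eq_bigr => i _; rewrite ffunE /inside indicE mem_setE.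
Qed.

Let prod_count : \prod_i ((p i true) *: 'X^(counted i) + (p i false)%:P) =
  count_pgf k l a b.
Proof.
rewrite big_sumType /= /count_pgf prodr_const card_ord expr1; congr (_ * _).
transitivity (\prod_(i < k) (a *: 'X^(i < k.-1)%N + (1 - a)%:P)) => //.
(* The masked last index contributes the factor a + (1 - a) = 1. *)
case: k k0 => // k' _ /=; rewrite big_ord_recr /= ltnn expr0 alg_polyC.
rewrite -polyCD [a + _]addrC subrK mulr1.
rewrite (eq_bigr (fun _ => a *: 'X + (1 - a)%:P)) ?prodr_const ?card_ord//.
by move=> i _; rewrite ltn_ord expr1.
Qed.

Lemma prob_count_le_eq j :
  fine (P [set t | count_le (fun i => X i : T -> R) (fun j => Y j : T -> R) x t
                   = j%:R]) = (count_pgf k l a b)`_j.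
Proof.
rewrite -prod_count -sum_prod_count.
rewrite -(prob_set_states (P := P) (st := inside)
  (fun s => count s == j) measurable_inside prob_state).
congr (fine (P _)); apply/seteqP; split => t /=; rewrite count_leE.
  by move=> /eqP; rewrite eqr_nat.
by move=> /eqP ->.
Qed.

Lemma prob_count_le_ge m N : (k + l <= N)%N ->
  fine (P [set t | m%:R <= count_le (fun i => X i : T -> R)
                             (fun j => Y j : T -> R) x t]) =
  \sum_(m <= j < N.+1) (count_pgf k l a b)`_j.
Proof.
move=> klN; rewrite -prod_count.
under [RHS]eq_bigr => j _ do rewrite -sum_prod_count big_mkcond.
rewrite exchange_big /=.
have -> : [set t | m%:R <= count_le (fun i => X i : T -> R)
                             (fun j => Y j : T -> R) x t] =
    [set t | (fun s : {ffun _ -> _} => (m <= count s)%N)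
               [ffun i => inside i t]].
  by apply/seteqP; split => t /=; rewrite count_leE ler_nat.
rewrite (prob_set_states (P := P) (st := inside)
  (fun s => (m <= count s)%N) measurable_inside prob_state).
rewrite big_mkcond; apply: eq_bigr => s _.
rewrite -big_mkcond (eq_bigl (fun j => j == count s)); last first.
  by move=> j; rewrite eq_sym.
rewrite big_nat1_eq.
have -> : (count s < N.+1)%N.
  rewrite ltnS (leq_trans _ klN)//.
  have -> : (k + l = #|{: 'I_k + 'I_l}|)%N by rewrite card_sum !card_ord.
  by rewrite -sum1_card leq_sum// => i _; case: (_ && _).
by rewrite andbT.
Qed.

End count_law.

(** * Identification of the polynomial identity with the law of the count *)

Theorem lemma2p2 (R : realType) (C : R -> R -> R) (hC : copula C)
  (* the random vector (U, V), with distribution function C *)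
  (d0 : measure_display) (T0 : measurableType d0) (P0 : probability T0 R)
  (U V : {RV P0 >-> R}) (hUV : joint_cdf P0 U V = C)
  (* n independent copies of (U, V) *)
  (n : nat)
  (d : measure_display) (T : measurableType d) (P : probability T R)
  (Us Vs : 'I_n -> {RV P >-> R})
  (hcopy : forall i : 'I_n,
     same_law P P0 (fun t => (Us i t, Vs i t)) (fun t => (U t, V t)))
  (hindep : mutually_independent P (fun (i : 'I_n) t => (Us i t, Vs i t)))
  (k m : nat) (hk : (1 <= k <= n)%N) (hm : (1 <= m <= n)%N)
  (* any version of the conditional law of U_{m:n} given V_{k:n} *)
  (kappa : R.-pker R ~> R)
  (hkappa : cond_distribution P
     (order_stat (fun i => Us i : T -> R) m)
     (order_stat (fun i => Vs i : T -> R) k) kappa) :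
  (forall u y : R, 0 <= u <= 1 -> 0 < y < 1 ->
     cond_prob P0 [set t | U t <= u] [set t | V t <= y] = C u y / y /\
     cond_prob P0 [set t | U t <= u] [set t | V t > y] =
       (u - C u y) / (1 - y)) /\
  {ae (@lebesgue_measure R \x @lebesgue_measure R)%E, forall xy : R * R,
     let x := xy.1 in let y := xy.2 in
     0 <= x <= 1 -> 0 <= y <= 1 ->
     derivable (C x) y 1 /\
     forall (d' : measure_display) (T' : measurableType d')
       (P' : probability T' R)
       (U1 : 'I_k -> {RV P' >-> R}) (U2 : 'I_(n - k) -> {RV P' >-> R}),
       mutually_independent P'
         (join_families (fun i => U1 i : T' -> R) (fun j => U2 j : T' -> R)) ->
       (forall (i : 'I_k) (u : R), 0 <= u <= 1 ->
          cdf (U1 i) u =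
            (cond_prob P0 [set t | U t <= u] [set t | V t <= y])%:E) ->
       (forall (j : 'I_(n - k)) (u : R), 0 <= u <= 1 ->
          cdf (U2 j) u =
            (cond_prob P0 [set t | U t <= u] [set t | V t > y])%:E) ->
       let N := count_le (fun i => U1 i : T' -> R) (fun j => U2 j : T' -> R) x in
       fine (kappa y `]-oo, x]%classic) =
         fine (P' [set t | N t >= m%:R]) +
         derive1 (C x) y * fine (P' [set t | N t = m%:R - 1])}.
Proof.
have mle (X : {RV P0 >-> R}) z : measurable [set t | X t <= z].
  by apply: measurable_set_ler => //; exact: measurable_funPT.
have PU u : 0 <= u <= 1 -> fine (P0 [set t | U t <= u]) = u.
  by move=> u01; rewrite (copula_margin1 hC hUV) uniform_prob_itv.
have PV y : 0 <= y <= 1 -> fine (P0 [set t | V t <= y]) = y.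
  by move=> y01; rewrite (copula_margin2 hC hUV) uniform_prob_itv.
have cond u y : 0 <= u <= 1 -> 0 < y < 1 ->
     cond_prob P0 [set t | U t <= u] [set t | V t <= y] = C u y / y /\
     cond_prob P0 [set t | U t <= u] [set t | V t > y] =
       (u - C u y) / (1 - y).
  move=> u01 /andP[/ltW y0 /ltW y1].
  have gtE : [set t | V t > y] = ~` [set t | V t <= y].
    by apply/seteqP; split => t /=; rewrite ltNge => /negP.
  rewrite /cond_prob PV ?y0//; split; first by rewrite -hUV.
  rewrite gtE; congr (_ / _).
    rewrite -{2}(PU u)// (measureDI P0 (mle U u) (mle V y)) fineD.
    - by rewrite -hUV /joint_cdf addrK setDE.
    - by rewrite fin_num_measure//; apply: measurableD.
    - by rewrite fin_num_measure//; apply: measurableI.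
  by rewrite probability_setC// fineB ?fin_num_measure// PV ?y0.
split; first exact: cond.
apply: filterS (ae_cond_identity hC hUV hcopy hindep hk hm hkappa).
  exact: (ae_filter_ringOfSetsType
            (@lebesgue_measure R \x @lebesgue_measure R)%E).
move=> [x y] /= h x01 y01; have [y01' dC hid] := h x01 y01; split => //.
move=> d' T' P' U1 U2 hind hU1 hU2.
have [/gt_eqF/negbT y0 y1] := andP y01'.
have y1n : 1 - y != 0 by rewrite subr_eq0 eq_sym lt_eqF.
have z01 : 0 <= (0 : R) <= 1 by rewrite lexx ler01.
(* The laws are given on rays while the count uses [0, x]. As C(0, y) = 0, the variables put no mass
   below 0 and the two probabilities agree. *)
have C0 : C 0 y = 0.
  have Cle : C 0 y <= fine (P0 [set t | U t <= 0]).
    have mUV : measurable ([set t | U t <= 0] `&` [set t | V t <= y]).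
      by apply: measurableI; exact: mle.
    rewrite -hUV /joint_cdf fine_le ?fin_num_measure//.
    by apply: measureIl; exact: mle.
  apply/eqP; rewrite eq_le; move: Cle; rewrite PU// => -> /=.
  by rewrite -hUV fine_ge0.
have inside_prob (Z : {RV P' >-> R}) q : cdf Z 0 = 0%E -> cdf Z x = q%:E ->
    fine (P' (Z @^-1` `[0, x]%classic)) = q.
  move=> Z0 Zx.
  have mneg : measurable (Z @^-1` `]-oo, 0[%classic).
    exact: measurable_funPTI.
  have min : measurable (Z @^-1` `[0, x]%classic).
    exact: measurable_funPTI.
  have neg0 : P' (Z @^-1` `]-oo, 0[%classic) = 0%E.
    apply/eqP; rewrite eq_le measure_ge0 andbT -Z0 /cdf.
    apply: le_measure; rewrite ?inE//.
      exact: measurable_funPTI.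
    by move=> t; rewrite /= !in_itv /= => /ltW.
  have : cdf Z x = (P' (Z @^-1` `]-oo, (0 : R)%R[%classic) +
                    P' (Z @^-1` `[(0 : R)%R, x]%classic))%E.
    rewrite -measureU//; last first.
      apply/seteqP; split => t //=; rewrite !in_itv /= => -[Zt /andP[]].
      by rewrite leNgt Zt.
    rewrite /cdf /distribution /pushforward; congr (P' _).
    apply/seteqP; split => t /=; rewrite !in_itv /=.
      by move=> Zt; have [_|_] := ltP (Z t) 0; [left|right].
    by case=> [/ltW Zt|/andP[]//]; rewrite (le_trans Zt)//; case/andP: x01.
  by rewrite Zx neg0 add0e => <-.
set a := C x y / y; set b := (x - C x y) / (1 - y).
have pU1 i : fine (P' (U1 i @^-1` `[0, x]%classic)) = a.
  apply: inside_prob; rewrite hU1//.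
    by rewrite (cond 0 y z01 y01').1 C0 mul0r.
  by rewrite (cond x y x01 y01').1.
have pU2 j : fine (P' (U2 j @^-1` `[0, x]%classic)) = b.
  apply: inside_prob; rewrite hU2//.
    by rewrite (cond 0 y z01 y01').2 C0 subr0 mul0r.
  by rewrite (cond x y x01 y01').2.
have [k0 kn] := andP hk; have [m0 mn] := andP hm.
have -> : m%:R - 1 = m.-1%:R :> R by rewrite -(natrB _ m0) subn1.
rewrite (prob_count_le_eq hind pU1 pU2 k0).
have kln : (k + (n - k) <= n)%N by rewrite subnKC.
rewrite (prob_count_le_ge hind pU1 pU2 k0 m kln).
(* In the notation A, B of the overview, A = y (a X + 1 - a) and B = (1 - y) (b X + 1 - b), with a
   and b the conditional probabilities of U <= x given V <= y and given V > y. *)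
have WE : below_pgf (C x y) y ^+ k.-1 * above_pgf (C x y) x y ^+ (n - k) =
    (y ^+ k.-1 * (1 - y) ^+ (n - k)) *: count_pgf k (n - k) a b.
  rewrite /count_pgf -scalerA scalerAr scalerAl -!exprZn.
  congr (_ ^+ _ * _ ^+ _).
    rewrite /below_pgf scalerDr scalerA scale_polyC; congr (_ *: _ + _%:P).
      by rewrite /a mulrC divfK.
    by rewrite /a mulrBr mulr1 [y * _]mulrC divfK.
  rewrite /above_pgf scalerDr scalerA scale_polyC; congr (_ *: _ + _%:P).
    by rewrite /b mulrC divfK.
  by rewrite /b mulrBr mulr1 [(1 - y) * _]mulrC divfK.
move: hid; rewrite /cond_identity WE.
set W := count_pgf _ _ _ _; set D := y ^+ _ * _; set c := derive1 _ _.
have sW : (size W <= n)%N.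
  rewrite (leq_trans (size_affineX_expM _ _ _ _ _ _))//.
  by rewrite -addSn prednK// subnKC.
have D0 : D != 0 by rewrite mulf_neq0 ?expf_neq0.
under eq_bigr => i _ do rewrite -scalerAr coefZ.
rewrite -mulr_sumr mulrC => /(mulfI D0) ->.
rewrite -[in LHS](prednK m0) sum_coef_affineXM// ?prednK//.
(* The sum for the count runs up to n, one index further than in [sum_coef_affineXM]; the extra
   coefficient is zero since [W] has size at most n. *)
congr (_ + _); rewrite big_nat_recr //=.
by rewrite (nth_default _ sW) addr0.
Qed.
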